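(* Suppose $F:\{0,1\}^*\to\{0,1\}^*$ is a weakly one-way function, so that for some integer $c>0$, $$(\forall\ \text{p.p.t. } \overline{G})\quad \big(\mathbb{P}^n\{\overline{F}\circ\overline{G}=I\}\le 1-n^{-c}\ \text{ almost always}\big).$$ Let $t=t(n)=n^{c+1}$ and define, for $x_0,x_1,\dots,x_{t-1}\in\{0,1\}^n$, $$F'(x_0x_1\cdots x_{t-1})=(F(x_0),F(x_1),\dots,F(x_{t-1})),$$ extended to inputs of all lengths as described in the context. Then $F'$ is a strongly one-way function.
   Context: A property of $n\in\mathbb{N}$ holds almost always (a.a.) if it holds for all sufficiently large $n$. A function $p:\mathbb{N}\to\mathbb{R}$ is negligible if for every $c>0$, $|p(n)|\le n^{-c}$ a.a. For $F:\{0,1\}^*\to\{0,1\}^*$, the auxiliary function is $\overline{F}(x)=(1^{|x|},F(x))$. Let $X_n$ be uniform on $\{0,1\}^n$, $Y_n=F(X_n)$, and $R_n$ be uniform on $\{0,1\}^{q(n)}$, independent of $X_n$, for some polynomial $q$. A p.p.t. (probabilistic polynomial time) function $\overline{G}$ is a partial function $\overline{G}(1^n,y,r)$ computable in time polynomial in $|(1^n,y)|$, where $r\in\{0,1\}^{q(n)}$ supplies the random bits. $\mathbb{P}^n$ is the distribution of $(1^n,Y_n,R_n)$ and $I(1^n,y,r)=(1^n,y)$, so $\mathbb{P}^n\{\overline{F}\circ\overline{G}=I\}$ is the probability that $\overline{G}(1^n,Y_n,R_n)$ is defined and $\overline{F}(\overline{G}(1^n,Y_n,R_n))=(1^n,Y_n)$.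 A polynomial time computable $F:\{0,1\}^*\to\{0,1\}^*$ is weakly one-way if there is a $c>0$ such that for all p.p.t. $\overline{G}$, $\mathbb{P}^n\{\overline{F}\circ\overline{G}=I\}\le1-n^{-c}$ a.a.; it is strongly one-way if for all $c>0$ and all p.p.t. $\overline{G}$, $\mathbb{P}^n\{\overline{F}\circ\overline{G}=I\}\le n^{-c}$ a.a. Tuples of strings are identified with strings via a fixed standard encoding that is polynomial time computable and decodable. The displayed formula defines $F'$ only on strings of length $\tau(n)=n\,t(n)=n^{c+2}$. It is extended to a string $x$ of arbitrary length by letting $n$ be the largest integer with $\tau(n)\le|x|$, writing $x=x'z$ with $|x'|=\tau(n)$, and setting $F'(x)=F'(x')z$ (concatenation). *)

(* Defs.v *)
From HB Require Import structures.
From mathcomp Require Import all_boot all_order all_algebra.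
From mathcomp Require Import all_classical all_reals all_analysis.

Set Implicit Arguments.
Unset Strict Implicit.
Unset Printing Implicit Defensive.

Import Order.TTheory GRing.Theory Num.Theory.
Local Open Scope ring_scope.

(* Multi-tape Turing machines over the alphabet {0, 1, blank}; blank is [None].
   A tape is bi-infinite and blank outside a finite zone: [(l, r)] has [l] to
   the left of the head (nearest cell first), and the scanned cell is the first
   one of [r]. *)

Definition symbol : Type := option bool.

Definition tape : Type := (seq symbol * seq symbol)%type.

Inductive move := Left | Stay | Right.

Definition scan (T : tape) : symbol := head None T.2.

Definition write (a : symbol) (T : tape) : tape := (T.1, a :: behead T.2).

Definition shift_head (d : move) (T : tape) : tape :=
  match d with
  | Left => (behead T.1, head None T.1 :: T.2)
  | Stay => T
  | Right => (head None T.2 :: T.1, behead T.2)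
  end.

(* [verdict s] is [None] when the state [s] is not halting, [Some true] when it
   is accepting and [Some false] when it is rejecting. *)
Record machine := Machine {
  extra_tapes : nat;
  state : finType;
  start : state;
  verdict : state -> option bool;
  delta : state -> {ffun 'I_extra_tapes.+1 -> symbol} ->
          state * {ffun 'I_extra_tapes.+1 -> symbol * move}
}.

Definition config (M : machine) : Type :=
  (state M * {ffun 'I_(extra_tapes M).+1 -> tape})%type.

Definition initial (M : machine) (w : seq bool) : config M :=
  (start M, [ffun i => if i == ord0 then ([::], map Some w) else ([::], [::])]).

Definition step (M : machine) (C : config M) : config M :=
  if verdict C.1 is Some _ then C
  else let: (s, acts) := delta C.1 [ffun i => scan (C.2 i)] in
       (s, [ffun i => shift_head (acts i).2 (write (acts i).1 (C.2 i))]).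

(* The output is read on tape 0, from the head rightwards to the first blank. *)
Fixpoint bits (s : seq symbol) : seq bool :=
  if s is Some b :: s' then b :: bits s' else [::].

Definition output (M : machine) (C : config M) : seq bool := bits (C.2 ord0).2.

(* On input [w], [M] halts within [t] steps (halting configurations are fixed
   by [step]); it accepts with output [v] if [o = Some v], and rejects if
   [o = None], which is how a machine signals an undefined value. *)
Definition computes_within (M : machine) (w : seq bool) (t : nat)
    (o : option (seq bool)) : Prop :=
  let C := iter t (@step M) (initial M w) in
  if o is Some v then verdict C.1 = Some true /\ output C = v
  else verdict C.1 = Some false.

(* Tuples of strings as strings: every bit [b] is written [1b], and each
   component is terminated by [0]. *)
Definition encode1 (x : seq bool) : seq bool :=
  rcons (flatten [seq [:: true; b] | b <- x]) false.

Definition encode (xs : seq (seq bool)) : seq bool := flatten (map encode1 xs).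

Definition unary (n : nat) : seq bool := nseq n true.

Definition poly_time (F : seq bool -> seq bool) : Prop :=
  exists (M : machine) (p : {poly nat}),
    forall x, computes_within M x p.[size x] (Some (F x)).

(* [G] is the partial function taking (1^n, y, r), and [q] gives the number of
   random bits; the time bound depends on (1^n, y) only. *)
Definition ppt (q : {poly nat})
    (G : seq bool -> seq bool -> seq bool -> option (seq bool)) : Prop :=
  exists (M : machine) (p : {poly nat}),
    forall (n : nat) (y r : seq bool), size r = q.[n] ->
      computes_within M (encode [:: unary n; y; r])
        p.[size (encode [:: unary n; y])] (G (unary n) y r).

Definition auxiliary (F : seq bool -> seq bool) (x : seq bool) :
  seq bool * seq bool := (unary (size x), F x).

Definition finite_uniform (R : realType) (T : finType) (A : {set T}) : R :=
  #|A|%:R / #|T|%:R.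

Definition inversion_prob (R : realType) (F : seq bool -> seq bool)
    (q : {poly nat}) (G : seq bool -> seq bool -> seq bool -> option (seq bool))
    (n : nat) : R :=
  finite_uniform R
    [set xr : n.-tuple bool * (q.[n]).-tuple bool |
       omap (auxiliary F) (G (unary n) (F xr.1) xr.2)
         == Some (unary n, F xr.1)].

Definition weakly_one_way (R : realType) (F : seq bool -> seq bool) : Prop :=
  poly_time F /\
  exists2 c : R, 0 < c & forall q G, ppt q G ->
    \forall n \near \oo%classic, inversion_prob R F q G n <= 1 - n%:R `^ (- c).

Definition strongly_one_way (R : realType) (F : seq bool -> seq bool) : Prop :=
  poly_time F /\
  forall c : R, 0 < c -> forall q G, ppt q G ->
    \forall n \near \oo%classic, inversion_prob R F q G n <= n%:R `^ (- c).

Definition copies (c n : nat) : nat := (n ^ c.+1)%N.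

Definition tau (c n : nat) : nat := (n * copies c n)%N.

Definition blockwise (F : seq bool -> seq bool) (c n : nat) (x : seq bool) :
  seq bool := encode [seq F y | y <- reshape (nseq (copies c n) n) x].

(* Since [n <= tau c n], the bound on the range of the maximum is harmless. *)
Definition block_length (c m : nat) : nat :=
  (\max_(n < m.+1 | tau c n <= m) n)%N.

Definition amplify (F : seq bool -> seq bool) (c : nat) (x : seq bool) :
  seq bool :=
  let n := block_length c (size x) in
  blockwise F c n (take (tau c n) x) ++ drop (tau c n) x.

(* Main.v *)
(** Suppose [G] inverts [F'] on inputs of length [m] with probability more than
    [m^-d]; let [n] be the block length and [t] the number of blocks.  Call
    [u] in {0,1}^n good for position [i] if planting [u] as the [i]-th block of
    a random input leaves [G] a success probability of at least
    [delta = m^-d / 2t].  Inputs with a bad block contribute at most [t delta]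
    to the success probability of [G], so if at every position the good blocks
    had density at most [1 - n^-c / 2], then [G] would succeed with probability
    at most [t delta + (1 - n^-c / 2)^t], which is below [m^-d] since [t] is
    [n^(c+1)].  Hence for some position [i] the density is larger.  Planting the
    challenge [F u] at that position and running [G] on polynomially many
    independent samples inverts [F] at every good [u], except with probability
    below [n^-c / 2], hence with probability more than [1 - n^-c] overall.
    The inverter knows neither [m] nor [i], but it can try all of them, as a
    candidate preimage can be checked by computing [F].

    Polynomial time is handled through closure properties: functions computed by
    programs over string registers are closed under composition, pairing and
    length-bounded iteration; such programs compile to Turing machines, and
    conversely a machine is simulated under a clock by iterating a transition
    function on coded configurations. *)

From HB Require Import structures.
Require Import Defs.
From mathcomp Require Import all_boot all_order all_algebra.
From mathcomp Require Import all_classical all_reals all_analysis.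
From mathcomp Require Import zify ring lra.

Set Implicit Arguments.
Unset Strict Implicit.
Unset Printing Implicit Defensive.

Import Order.TTheory GRing.Theory Num.Theory.
Local Open Scope nat_scope.

(** * Register programs and their compilation to Turing machines *)

Inductive prog :=
| Skip
| Push (i : nat) (b : bool)
| Pop (i : nat)
| Seq (p q : prog)
| If (i : nat) (f : symbol -> bool) (p q : prog)
| While (i : nat) (f : symbol -> bool) (p : prog).

Definition store := nat -> seq bool.

Definition upd (s : store) (i : nat) (w : seq bool) : store :=
  fun j => if j == i then w else s j.

(* The index of [exec] is the exact number of steps of the compiled machine. *)
Inductive exec : prog -> store -> nat -> store -> Prop :=
| ExecSkip s : exec Skip s 0 s
| ExecPush i b s : exec (Push i b) s 2 (upd s i (b :: s i))
| ExecPop i s : exec (Pop i) s 1 (upd s i (behead (s i)))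
| ExecSeq p q s1 s2 s3 m n :
    exec p s1 m s2 -> exec q s2 n s3 -> exec (Seq p q) s1 (m + n.+1) s3
| ExecIf i (f : symbol -> bool) p q s n s' :
    exec (if f (ohead (s i)) then p else q) s n s' ->
    exec (If i f p q) s n.+2 s'
| ExecStop i (f : symbol -> bool) p s : ~~ f (ohead (s i)) -> exec (While i f p) s 1 s
| ExecLoop i (f : symbol -> bool) p s1 s2 s3 m n :
    f (ohead (s1 i)) -> exec p s1 m s2 -> exec (While i f p) s2 n s3 ->
    exec (While i f p) s1 (m.+1 + n.+1) s3.

Fixpoint width (p : prog) : nat :=
  match p with
  | Skip => 0
  | Push i _ | Pop i => i.+1
  | Seq p q => maxn (width p) (width q)
  | If i _ p q => maxn i.+1 (maxn (width p) (width q))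
  | While i _ p => maxn i.+1 (width p)
  end.

(** A machine with a single exit state and no verdicts: this is what can be glued when programs are
    composed. *)
Record fragment (K : nat) := Fragment {
  fstate : finType;
  fstart : fstate;
  fstop : fstate;
  fdelta : fstate -> {ffun 'I_K.+1 -> symbol} ->
           fstate * {ffun 'I_K.+1 -> symbol * move}
}.

Section Compile.
Variable K : nat.
Implicit Types (A B : fragment K) (v : {ffun 'I_K.+1 -> symbol}).

Definition fconfig A : Type := (fstate A * {ffun 'I_K.+1 -> tape})%type.

Definition fstep A (C : fconfig A) : fconfig A :=
  let: (s, acts) := fdelta C.1 [ffun i => scan (C.2 i)] in
  (s, [ffun i => shift_head (acts i).2 (write (acts i).1 (C.2 i))]).

(** No transition may leave the exit state, so a larger fragment is free to use that state for
    passing control on. *)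
Fixpoint steps A (n : nat) (C C' : fconfig A) : Prop :=
  if n is n'.+1 then C.1 != fstop A /\ steps n' (fstep C) C' else C = C'.

Lemma steps_trans A m n (C1 C2 C3 : fconfig A) :
  steps m C1 C2 -> steps n C2 C3 -> steps (m + n) C1 C3.
Proof. by elim: m C1 => [|m IH] C1 /= => [->|[H1 /IH H2] /H2]. Qed.

(** Transitions need to agree only away from the exit state of [A], where the surrounding fragment
    installs its own transition. *)
Lemma steps_embed A B (e : fstate A -> fstate B) :
  (forall s, s != fstop A -> e s != fstop B /\
     forall v, fdelta (e s) v = (e (fdelta s v).1, (fdelta s v).2)) ->
  forall n (C C' : fconfig A),
    steps n C C' -> steps n (e C.1, C.2) (e C'.1, C'.2).
Proof.
move=> He; elim=> [|n IH] C C' /= => [->//|[H1 /IH H2]].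
have [H3 H4] := He _ H1; split=> //.
suff -> : @fstep B (e C.1, C.2) = (e (fstep C).1, (fstep C).2) by [].
by rewrite /fstep /= H4; case: (fdelta C.1 _).
Qed.

Definition act (i : nat) (g : symbol -> symbol * move) v :=
  [ffun j : 'I_K.+1 => if (j : nat) == i then g (v j) else (v j, Stay)].

Definition idle v := [ffun j : 'I_K.+1 => (v j, Stay)].

Definition skip_fragment : fragment K :=
  @Fragment K unit tt tt (fun s v => (s, idle v)).

(** Two steps are needed: a machine writes before it moves, and the new top belongs in the blank
    cell to the left of the head. *)
Definition push_fragment (i : nat) (b : bool) : fragment K :=
  @Fragment K (option bool) None (Some true) (fun s v =>
    if s is None then (Some false, act i (fun a => (a, Left)) v)
    else (Some true, act i (fun=> (Some b, Stay)) v)).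

Definition pop_fragment (i : nat) : fragment K :=
  @Fragment K bool false true (fun s v => (true, act i (fun=> (None, Right)) v)).

Definition seq_fragment A B : fragment K :=
  @Fragment K (fstate A + fstate B)%type (inl (fstart A)) (inr (fstop B))
    (fun s v => match s with
     | inl s => if s == fstop A then (inr (fstart B), idle v)
                else (inl (fdelta s v).1, (fdelta s v).2)
     | inr s => (inr (fdelta s v).1, (fdelta s v).2)
     end).

Definition if_fragment (i : nat) (f : symbol -> bool) A B : fragment K :=
  @Fragment K (bool + (fstate A + fstate B))%type (inl false) (inl true)
    (fun s v => match s with
     | inl _ => (if f (v (inord i)) then inr (inl (fstart A))
                 else inr (inr (fstart B)), idle v)
     | inr (inl s) => if s == fstop A then (inl true, idle v)
                      else (inr (inl (fdelta s v).1), (fdelta s v).2)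
     | inr (inr s) => if s == fstop B then (inl true, idle v)
                      else (inr (inr (fdelta s v).1), (fdelta s v).2)
     end).

Definition while_fragment (i : nat) (f : symbol -> bool) A : fragment K :=
  @Fragment K (bool + fstate A)%type (inl false) (inl true)
    (fun s v => match s with
     | inl _ => (if f (v (inord i)) then inr (fstart A) else inl true, idle v)
     | inr s => if s == fstop A then (inl false, idle v)
                else (inr (fdelta s v).1, (fdelta s v).2)
     end).

Fixpoint compile (p : prog) : fragment K :=
  match p with
  | Skip => skip_fragment
  | Push i b => push_fragment i b
  | Pop i => pop_fragment i
  | Seq p q => seq_fragment (compile p) (compile q)
  | If i f p q => if_fragment i f (compile p) (compile q)
  | While i f p => while_fragment i f (compile p)
  end.

(* Visited cells of a blank zone are stored explicitly, hence the padding. *)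
Definition holds (T : tape) (w : seq bool) : Prop :=
  all (pred1 None) T.1 /\ exists j, T.2 = map Some w ++ nseq j None.

Lemma holds_scan T w : holds T w -> scan T = ohead w.
Proof. by case=> _ [j]; rewrite /scan => ->; case: w => //; case: j. Qed.

Lemma holds_idle T w : holds T w -> holds (shift_head Stay (write (scan T) T)) w.
Proof.
case: T => l r [/= H1 [j ->]]; split=> //=.
by case: w => [|b w]; [exists j.-1.+1; case: j | exists j].
Qed.

Lemma holds_push T w b :
  holds T w -> holds (write (Some b) (shift_head Left (write (scan T) T))) (b :: w).
Proof.
move/holds_idle; case: T => l r [/= H1 [j /= ->]]; split; last by exists j.
by case: l H1 => //= ? ? /andP[].
Qed.

Lemma holds_pop T w : holds T w -> holds (shift_head Right (write None T)) (behead w).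
Proof.
case: T => l r [/= H1 [j ->]]; split; rewrite //=.
by case: w => [|b w]; [exists j.-1; case: j | exists j].
Qed.

Definition holds_all (T : {ffun 'I_K.+1 -> tape}) (s : store) : Prop :=
  forall i, holds (T i) (s i).

(** The glue between fragments: one step that passes control and leaves register contents alone,
    changing at most the blank padding. *)
Lemma jump A (C : fconfig A) s' s :
  C.1 != fstop A ->
  fdelta C.1 [ffun i => scan (C.2 i)] = (s', idle [ffun i => scan (C.2 i)]) ->
  holds_all C.2 s ->
  exists T, steps 1 C (s', T) /\ holds_all T s.
Proof.
move=> H1 H2 H3; exists (fstep C).2; split.
  by split; rewrite //= /fstep H2.
by rewrite /fstep H2 => j /=; rewrite !ffunE; apply: holds_idle.
Qed.

(** Induction on the run. Sub-runs are transported by [steps_embed] and linked by [jump]; each jump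
    accounts for one unit of the overhead counted in [exec]. *)
Lemma compile_correct p s n s' : exec p s n s' -> width p <= K.+1 ->
  forall T, holds_all T s ->
  exists T', @steps (compile p) n (fstart (compile p), T) (fstop (compile p), T') /\
             holds_all T' s'.
Proof.
elim=> {p s n s'}.
- by move=> s _ T H; exists T.
- move=> i b s lt_iK T H; eexists; split; first by do 2!split=> //.
  move=> j; rewrite /upd /= !ffunE; case: eqP => E.
    by rewrite -E; apply: holds_push.
  by rewrite -/(write _ _) -/(scan _); apply/holds_idle/holds_idle.
- move=> i s lt_iK T H; eexists; split; first by split.
  move=> j; rewrite /upd /= !ffunE; case: eqP => E.
    by rewrite -E; apply: holds_pop.
  exact: holds_idle.
- move=> p q s1 s2 s3 m n _ IH1 _ IH2; rewrite /= geq_max => /andP[W1 W2] T1 H1.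
  have [T2 [S1 H2]] := IH1 W1 T1 H1.
  pose AB := seq_fragment (compile p) (compile q).
  have [//|/=|//|T3 [S2 H3]] := @jump AB (inl (fstop (compile p)), T2)
    (inr (fstart (compile q))) s2; first by rewrite eqxx.
  have [T4 [S3 H4]] := IH2 W2 T3 H3.
  exists T4; split=> //.
  have E1 : forall s, s != fstop (compile p) -> (inl s : fstate AB) != fstop AB /\
    forall v, @fdelta K AB (inl s) v = (inl (fdelta s v).1, (fdelta s v).2).
    by move=> s /negbTE /= ->.
  have E2 : forall s, s != fstop (compile q) -> (inr s : fstate AB) != fstop AB /\
    forall v, @fdelta K AB (inr s) v = (inr (fdelta s v).1, (fdelta s v).2).
    by move=> s /=.
  apply: steps_trans (steps_embed E1 S1) _.
  exact: steps_trans S2 (steps_embed E2 S3).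
- move=> i f p q s n s' _ IH.
  move=> W T1 H1.
  have /and3P[lt_iK W1 W2] : [&& i < K.+1, width p <= K.+1 & width q <= K.+1]
    by rewrite -!geq_max.
  pose AB := if_fragment i f (compile p) (compile q).
  (* The bound on the width gives [i < K.+1], so [inord i] is tape [i] itself and not a default
     tape. *)
  have Ei : scan (T1 (inord i)) = ohead (s i).
    by rewrite (holds_scan (H1 _)) inordK.
  have E1 : forall s, s != fstop (compile p) -> (inr (inl s) : fstate AB) != fstop AB /\
    forall v, @fdelta K AB (inr (inl s)) v = (inr (inl (fdelta s v).1), (fdelta s v).2).
    by move=> ? /negbTE /= ->.
  have E2 : forall s, s != fstop (compile q) -> (inr (inr s) : fstate AB) != fstop AB /\
    forall v, @fdelta K AB (inr (inr s)) v = (inr (inr (fdelta s v).1), (fdelta s v).2).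
    by move=> ? /negbTE /= ->.
  have [//|/=|//|T2 [S1 H2]] := @jump AB (inl false, T1)
    (if f (ohead (s i)) then inr (inl (fstart (compile p)))
     else inr (inr (fstart (compile q)))) s; first by rewrite !ffunE Ei.
  have W' : width (if f (ohead (s i)) then p else q) <= K.+1 by case: ifP.
  have [T3 [S2 H3]] := IH W' T2 H2.
  have [T4 [S3 H4]] : exists T4, steps 1 ((if f (ohead (s i)) then inr (inl (fstop (compile p)))
     else inr (inr (fstop (compile q))), T3) : fconfig AB) (inl true, T4) /\ holds_all T4 s'.
    by apply: jump => //=; case: ifP => //= _; rewrite eqxx.
  exists T4; split; last by [].
  rewrite (_ : n.+2 = 1 + (n + 1)); last by lia.
  apply: steps_trans S1 _.
  apply: steps_trans S3.
  case: ifP S2 => _ S2; [exact: (steps_embed E1 S2) | exact: (steps_embed E2 S2)].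
- move=> i f p s Hf; rewrite /= !geq_max => /andP[lt_iK W1] T1 H1.
  pose AB := while_fragment i f (compile p).
  have Ei : scan (T1 (inord i)) = ohead (s i).
    by rewrite (holds_scan (H1 _)) inordK.
  have [//|/=|//|T2 [S1 H2]] := @jump AB (inl false, T1) (inl true) s.
    by rewrite !ffunE Ei (negbTE Hf).
  by exists T2.
- move=> i f p s1 s2 s3 m n Hf _ IH1 _ IH2.
  move=> W T1 H1.
  have /andP[lt_iK W1] : (i < K.+1) && (width p <= K.+1) by rewrite -geq_max.
  pose AB := while_fragment i f (compile p).
  have Ei : scan (T1 (inord i)) = ohead (s1 i).
    by rewrite (holds_scan (H1 _)) inordK.
  have [//|/=|//|T2 [S1 H2]] := @jump AB (inl false, T1)
    (inr (fstart (compile p))) s1; first by rewrite !ffunE Ei Hf.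
  have [T3 [S2 H3]] := IH1 W1 T2 H2.
  have [//|/=|//|T4 [S3 H4]] := @jump AB (inr (fstop (compile p)), T3)
    (inl false) s2; first by rewrite eqxx.
  have [|T5 [S4 H5]] := IH2 _ T4 H4; first by rewrite !geq_max lt_iK.
  exists T5; split; last by [].
  have E1 : forall s, s != fstop (compile p) -> (inr s : fstate AB) != fstop AB /\
    forall v, @fdelta K AB (inr s) v = (inr (fdelta s v).1, (fdelta s v).2).
    by move=> ? /negbTE /= ->.
  rewrite (_ : m.+1 + n.+1 = 1 + (m + (1 + n))); last by lia.
  apply: steps_trans S1 _.
  apply: steps_trans (steps_embed E1 S2) _.
  exact: steps_trans S3 S4.
Qed.

Definition fragment_machine A : machine :=
  @Machine K (fstate A) (fstart A)
    (fun s => if s == fstop A then Some true else None) (@fdelta K A).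

Lemma iter_step_steps A n (C C' : fconfig A) :
  steps n C C' -> iter n (@step (fragment_machine A)) C = C'.
Proof.
elim: n C => // n IH C [H1 /IH <-]; rewrite iterSr; congr (iter n _ _).
by rewrite /step /= (negbTE H1).
Qed.

End Compile.

Definition input_store (x : seq bool) : store := upd (fun=> [::]) 0 x.

Definition program_machine (p : prog) : machine :=
  fragment_machine (compile (width p) p).

Lemma bits_map_Some (w : seq bool) j : bits (map Some w ++ nseq j None) = w.
Proof. by elim: w => [|b w /= ->//]; case: j. Qed.

Lemma computes_within_mono M w t t' o :
  t <= t' -> computes_within M w t o -> computes_within M w t' o.
Proof.
move=> /subnK <-; rewrite /computes_within iterD.
set C := iter t _ _.
have H : verdict C.1 -> forall k, iter k (@step M) C = C.
  move=> H; elim=> //= k ->; rewrite /step.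
  by case: (verdict C.1) H.
case: o => [v [H1 H2]|H1]; rewrite H ?H1 //.
Qed.

Lemma program_machine_computes p x n y :
  exec p (input_store x) n (input_store y) ->
  computes_within (program_machine p) x n (Some y).
Proof.
move=> H; have [|T' [S HT]] := compile_correct H (leqnSn _)
  (T := (initial (program_machine p) x).2).
  move=> i; rewrite /= ffunE /input_store /upd.
  rewrite -val_eqE /=.
  by case: eqP => _; split=> //; exists 0; rewrite /= ?cats0.
rewrite /computes_within.
have -> : iter n (@step (program_machine p)) (initial (program_machine p) x) =
  (fstop (compile (width p) p), T') by apply: iter_step_steps S.
split; first by rewrite /= eqxx.
by have [_ [j E]] := HT ord0; rewrite /output /= E bits_map_Some.
Qed.

(** * Functions computed by programs in polynomial time *)

Definition poly_bounded (T : nat -> nat) : Prop :=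
  exists P : {poly nat}, forall n, T n <= P.[n]%R.

Lemma horner_nat_mono (P : {poly nat}) m n : m <= n -> P.[m]%R <= P.[n]%R.
Proof.
move=> le_mn; elim/poly_ind: P => [|P c IH]; first by rewrite !horner0.
rewrite !hornerMXaddC.
by apply: leq_add => //; apply: leq_mul.
Qed.

Lemma poly_bounded_horner (P : {poly nat}) : poly_bounded (fun n => P.[n]%R).
Proof. by exists P. Qed.

Lemma poly_bounded_const c : poly_bounded (fun=> c).
Proof. by exists (c%:P)%R => n; rewrite hornerC. Qed.

Lemma poly_bounded_id : poly_bounded (fun n => n).
Proof. by exists 'X%R => n; rewrite hornerX. Qed.

Lemma poly_bounded_add T U :
  poly_bounded T -> poly_bounded U -> poly_bounded (fun n => T n + U n).
Proof.
by move=> [P HP] [Q HQ]; exists (P + Q)%R => n; rewrite hornerD leq_add.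
Qed.

Lemma poly_bounded_mul T U :
  poly_bounded T -> poly_bounded U -> poly_bounded (fun n => T n * U n).
Proof.
by move=> [P HP] [Q HQ]; exists (P * Q)%R => n; rewrite hornerM leq_mul.
Qed.

Lemma poly_bounded_succ T : poly_bounded T -> poly_bounded (fun n => (T n).+1).
Proof.
move=> HT; have [P HP] := poly_bounded_add HT (poly_bounded_const 1).
by exists P => n; rewrite -addn1.
Qed.

Lemma poly_bounded_exp T k : poly_bounded T -> poly_bounded (fun n => T n ^ k).
Proof.
move=> HT; elim: k => [|k IH]; first exact: poly_bounded_const.
have [P HP] := poly_bounded_mul HT IH.
by exists P => n; rewrite expnS.
Qed.

Lemma poly_bounded_comp (P : {poly nat}) U :
  poly_bounded U -> poly_bounded (fun n => P.[U n]%R).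
Proof.
move=> [Q HQ]; exists (P \Po Q)%R => n.
by rewrite horner_comp horner_nat_mono.
Qed.

Ltac pbound := repeat first
  [ exact: poly_bounded_const | exact: poly_bounded_id
  | exact: poly_bounded_horner | apply: poly_bounded_succ
  | apply: poly_bounded_add | apply: poly_bounded_mul
  | apply: poly_bounded_exp | apply: poly_bounded_comp ].

Definition runs (p : prog) (s : store) (T : nat) (s' : store) : Prop :=
  exists2 n, n <= T & exec p s n s'.

Lemma runs_le p s T T' s' : T <= T' -> runs p s T s' -> runs p s T' s'.
Proof. by move=> le_TT' [n H1 H2]; exists n => //; apply: leq_trans le_TT'. Qed.

Lemma runs_seq p q s1 s2 s3 a b :
  runs p s1 a s2 -> runs q s2 b s3 -> runs (Seq p q) s1 (a + b).+1 s3.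
Proof.
move=> [m H1 H2] [n H3 H4]; exists (m + n.+1); last exact: ExecSeq H2 H4.
by rewrite addnS ltnS leq_add.
Qed.

Lemma upd_same s i w : upd s i w i = w.
Proof. by rewrite /upd eqxx. Qed.

Lemma upd_id s i : upd s i (s i) = s.
Proof. by apply/funext => j; rewrite /upd; case: eqP => [->|]. Qed.

Lemma updK s i u v : upd (upd s i u) i v = upd s i v.
Proof. by apply/funext => j; rewrite /upd; case: eqP. Qed.

Lemma upd_comm s i j u v : i != j -> upd (upd s i u) j v = upd (upd s j v) i u.
Proof.
move=> /eqP ne; apply/funext => k; rewrite /upd.
by case: eqP => // ->; case: eqP => // E; case: ne.
Qed.

(** Registers from [W] on are neither read nor written, so a larger program can store data there
    while [p] runs. *)
Lemma exec_frame p s n s' W t : exec p s n s' -> width p <= W ->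
  (forall i, i < W -> t i = s i) ->
  exec p t n (fun i => if i < W then s' i else t i).
Proof.
move=> H; elim: H t => {p s n s'}.
- move=> s t _ E; suff -> : (fun i => if i < W then s i else t i) = t by constructor.
  by apply/funext => i; case: ltnP => // /E.
- move=> i b s t lt_iW E.
  suff -> : (fun j => if j < W then upd s i (b :: s i) j else t j) =
            upd t i (b :: t i) by constructor.
  apply/funext => j; rewrite /upd; case: eqP => [->|ne]; first by rewrite ifT ?E.
  by case: ltnP => // /E.
- move=> i s t lt_iW E.
  suff -> : (fun j => if j < W then upd s i (behead (s i)) j else t j) =
            upd t i (behead (t i)) by constructor.
  apply/funext => j; rewrite /upd; case: eqP => [->|ne]; first by rewrite ifT ?E.
  by case: ltnP => // /E.
- move=> p q s1 s2 s3 m n _ IH1 _ IH2 t; rewrite geq_max => /andP[W1 W2] E.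
  apply: ExecSeq (IH1 _ W1 E) _.
  have -> : (fun i => if i < W then s3 i else t i) =
    (fun i => if i < W then s3 i else
       if i < W then s2 i else t i) by apply/funext => i; case: ltnP.
  by apply: IH2 => // i ->.
- move=> i f p q s n s' _ IH t; rewrite !geq_max => /and3P[lt_iW W1 W2] E.
  by apply: ExecIf; rewrite E //; apply: IH => //; case: ifP.
- move=> i f p s Hf t; rewrite geq_max => /andP[lt_iW W1] E.
  have -> : (fun i => if i < W then s i else t i) = t.
    by apply/funext => j; case: ltnP => // /E.
  by apply: ExecStop; rewrite E.
- move=> i f p s1 s2 s3 m n Hf _ IH1 _ IH2 t; rewrite geq_max => /andP[lt_iW W1] E.
  apply: ExecLoop (IH1 _ W1 E) _; first by rewrite E.
  have -> : (fun i => if i < W then s3 i else t i) =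
    (fun i => if i < W then s3 i else
       if i < W then s2 i else t i) by apply/funext => j; case: ltnP.
  by apply: IH2 => [|j ->//]; rewrite geq_max lt_iW.
Qed.

(** A time bound is thus also a bound on the length of the result, which is what makes polynomial
    bounds compose. *)
Lemma exec_size p s n s' : exec p s n s' -> forall i, size (s' i) <= size (s i) + n.
Proof.
elim=> {p s n s'}.
- by move=> s i; rewrite addn0.
- by move=> i b s j; rewrite /upd; case: eqP => [->|_] /=; lia.
- by move=> i s j; rewrite /upd; case: eqP => [->|_] /=; rewrite ?size_behead; lia.
- by move=> p q s1 s2 s3 m n _ IH1 _ IH2 i; have := IH1 i; have := IH2 i; lia.
- by move=> i f p q s n s' _ IH j; have := IH j; lia.
- by move=> i f p s _ j; lia.
- by move=> i f p s1 s2 s3 m n _ _ IH1 _ IH2 j; have := IH1 j; have := IH2 j; lia.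
Qed.

Lemma input_store0 x : input_store x 0 = x.
Proof. exact: upd_same. Qed.

Lemma upd_input_store x y : upd (input_store x) 0 y = input_store y.
Proof. exact: updK. Qed.

(* Registers other than the input-output register 0 must be empty at the start
   and are left empty, so that such programs compose. *)
Definition poly_fun (f : seq bool -> seq bool) : Prop :=
  exists2 p, 0 < width p & exists2 T, poly_bounded T &
    forall x, runs p (input_store x) (T (size x)) (input_store (f x)).

(* Touches register 0, so that the width is positive. *)
Definition padded (p : prog) : prog := Seq (Push 0 true) (Seq (Pop 0) p).

Lemma poly_funI p f T : poly_bounded T ->
  (forall x, runs p (input_store x) (T (size x)) (input_store (f x))) ->
  poly_fun f.
Proof.
move=> HT H; exists (padded p); first by rewrite /=; lia.
exists (fun n => T n + 10); first by pbound.
move=> x; have [n le_nT Hn] := H x.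
exists (2 + (1 + n.+1).+1); first by lia.
apply: ExecSeq; first exact: ExecPush.
apply: ExecSeq; first exact: ExecPop.
by rewrite upd_input_store !input_store0 /= upd_input_store.
Qed.

Lemma poly_funP f : poly_fun f ->
  exists p, exists P : {poly nat}, 0 < width p /\
   (forall x, size (f x) <= size x + P.[size x]%R) /\
   forall W s m, width p <= W -> size (s 0) <= m ->
     (forall i, 0 < i -> i < W -> s i = [::]) ->
     runs p s P.[m]%R (upd s 0 (f (s 0))).
Proof.
move=> [p W0 [T [P HP] H]]; exists p, P; split=> //; split.
  move=> x; have [n le_nT /exec_size /(_ 0)] := H x.
  rewrite !input_store0 => Hs; apply: leq_trans Hs _; rewrite leq_add2l.
  exact: leq_trans (leq_trans le_nT (HP _)).
move=> W s m W1 le_m Hs; have [n le_nT Hn] := H (s 0).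
exists n.
  by apply: leq_trans le_nT (leq_trans (HP _) _); apply: horner_nat_mono.
have := exec_frame (t := s) Hn W1.
have -> : (fun i => if i < W then input_store (f (s 0)) i else s i) =
          upd s 0 (f (s 0)).
  apply/funext => -[|i]; first by rewrite input_store0 upd_same (leq_trans W0 W1).
  by rewrite /input_store /upd /=; case: ltnP => // ?; rewrite Hs.
apply=> -[|i] lt_iW; first by rewrite input_store0.
by rewrite Hs.
Qed.

Lemma poly_fun_size f : poly_fun f ->
  exists P : {poly nat}, forall x, size (f x) <= P.[size x]%R.
Proof.
move=> /poly_funP[_ [P [_ [H _]]]]; exists ('X + P)%R => x.
by rewrite hornerD hornerX.
Qed.

Lemma poly_fun_time f : poly_fun f -> poly_time f.
Proof.
move=> [p _ [T [P HP] H]]; exists (program_machine p), P => x.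
have [n le_nT Hn] := H x.
by apply: computes_within_mono (program_machine_computes Hn); apply: leq_trans (HP _).
Qed.

Lemma poly_fun_ext f g : f =1 g -> poly_fun f -> poly_fun g.
Proof. by move=> /funext ->. Qed.

Lemma poly_fun_id : poly_fun (fun x => x).
Proof.
apply: (@poly_funI Skip _ (fun=> 0)) => [|x]; first by pbound.
by exists 0 => //; constructor.
Qed.

Lemma poly_fun_cons b : poly_fun (cons b).
Proof.
apply: (@poly_funI (Push 0 b) _ (fun=> 2)) => [|x]; first by pbound.
exists 2 => //; have := ExecPush 0 b (input_store x).
by rewrite input_store0 upd_input_store.
Qed.

Lemma poly_fun_behead : poly_fun behead.
Proof.
apply: (@poly_funI (Pop 0) _ (fun=> 1)) => [|x]; first by pbound.
exists 1 => //; have := ExecPop 0 (input_store x).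
by rewrite input_store0 upd_input_store.
Qed.

Lemma runs_fun (f : seq bool -> seq bool) p (P : {poly nat}) W s s' x :
  (forall W s m, width p <= W -> size (s 0) <= m ->
     (forall i, 0 < i -> i < W -> s i = [::]) ->
     runs p s P.[m]%R (upd s 0 (f (s 0)))) ->
  width p <= W -> s 0 = x -> (forall i, 0 < i -> i < W -> s i = [::]) ->
  upd s 0 (f x) = s' -> runs p s P.[size x]%R s'.
Proof. by move=> H W1 E Hs <-; rewrite -E; apply: H Hs. Qed.

Lemma poly_fun_comp f g : poly_fun f -> poly_fun g -> poly_fun (fun x => f (g x)).
Proof.
move=> /poly_funP[p [P [W1 [S1 H1]]]] /poly_funP[q [Q [W2 [S2 H2]]]].
apply: (@poly_funI (Seq q p) _ (fun n => (Q.[n]%R + P.[(n + Q.[n]%R)%N]%R).+1)).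
  by pbound.
move=> x; apply: (@runs_seq _ _ _ (input_store (g x))).
  apply: (runs_fun H2 (leqnn _)); first exact: input_store0.
    by move=> [].
  exact: upd_input_store.
apply: runs_le (horner_nat_mono P (S2 x)) _.
apply: (runs_fun H1 (leqnn _)); first exact: input_store0.
  by move=> [].
exact: upd_input_store.
Qed.

Lemma poly_fun_case f g : poly_fun f -> poly_fun g ->
  poly_fun (fun x => if head false x then f x else g x).
Proof.
move=> /poly_funP[p [P [W1 [S1 H1]]]] /poly_funP[q [Q [W2 [S2 H2]]]].
apply: (@poly_funI (If 0 (pred1 (Some true)) p q) _ (fun n => (Q.[n]%R + P.[n]%R).+2)).
  by pbound.
move=> x.
have [n1 L1 E1] : runs p (input_store x) P.[size x]%R (input_store (f x)).
  apply: (runs_fun H1 (leqnn _)); [exact: input_store0| by move=> []|].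
  exact: upd_input_store.
have [n2 L2 E2] : runs q (input_store x) Q.[size x]%R (input_store (g x)).
  apply: (runs_fun H2 (leqnn _)); [exact: input_store0| by move=> []|].
  exact: upd_input_store.
exists (if head false x then n1 else n2).+2; first by case: ifP => _; lia.
apply: ExecIf; rewrite input_store0.
have /= -> : (ohead x == Some true) = head false x by case: (x) => [|[]].
by case: (head false x).
Qed.

(** The branch is taken before the pop, so the control remembers the bit that is removed. Moving,
    copying and encoding are all instances. *)
Definition drain (i : nat) (b : bool -> prog) : prog :=
  While i isSome (If i (pred1 (Some true))
    (Seq (Pop i) (b true)) (Seq (Pop i) (b false))).

(** The two hypotheses on [g] say that the body is a [k]-step action that neither reads nor changes
    register [i]. The 6 counts one pop, one sequencing step, two steps of the test and two of the
    loop. *)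
Lemma runs_drain i b (g : bool -> store -> store) k s :
  (forall a s, exec (b a) s k (g a s)) ->
  (forall a s w, g a (upd s i w) = upd (g a s) i w) ->
  runs (drain i b) s (size (s i) * (k + 6)).+1
    (foldl (fun s a => g a s) (upd s i [::]) (s i)).
Proof.
move=> Hb Hg; exists (size (s i) * (k + 6)).+1 => //.
move E: (s i) => w; elim: w s E => [|a w IH] s E.
  by rewrite /= -E upd_id; apply: ExecStop; rewrite E.
have -> : (size (a :: w) * (k + 6)).+1 = (1 + k.+1).+2.+1 + (size w * (k + 6)).+2.
  by rewrite /= mulSn; lia.
apply: ExecLoop; first by rewrite E.
  apply: ExecIf; rewrite E.
  have -> : (if pred1 (Some true) (ohead (a :: w)) then Seq (Pop i) (b true)
             else Seq (Pop i) (b false)) = Seq (Pop i) (b a) by case: (a).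
  have H1 : exec (Pop i) s 1 (upd s i w) by have := ExecPop i s; rewrite E.
  exact: ExecSeq H1 (Hb a _).
have := IH (g a (upd s i w)); rewrite !Hg upd_same => /(_ erefl).
by rewrite !updK /= !Hg.
Qed.

Ltac store_cases :=
  apply/funext => ?; rewrite /input_store /upd;
  repeat (case: eqP => ?); try done; try lia.

(** Registers are stacks, so pouring one onto another reverses it; below, moves come in pairs to
    restore the order. *)
Lemma runs_move i j s : i != j ->
  runs (drain i (Push j)) s (size (s i) * 8).+1
    (upd (upd s i [::]) j (rev (s i) ++ s j)).
Proof.
move=> ne; have Hg a s' w : upd (upd s' i w) j (a :: upd s' i w j) =
    upd (upd s' j (a :: s' j)) i w.
  by rewrite (upd_comm _ _ _ ne) /upd eq_sym (negbTE ne).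
have := runs_drain s (ExecPush j) Hg.
congr (runs _ _ _ _).
have -> : s j = upd s i [::] j by rewrite /upd eq_sym (negbTE ne).
elim: (s i) (upd s i [::]) => [|a w IH] t /=; first by rewrite upd_id.
by rewrite IH updK upd_same rev_cons cat_rcons.
Qed.

Lemma runs_copy i j k s : i != j -> i != k -> j != k ->
  runs (drain i (fun a => Seq (Push j a) (Push k a))) s (size (s i) * 11).+1
    (upd (upd (upd s i [::]) j (rev (s i) ++ s j)) k (rev (s i) ++ s k)).
Proof.
move=> ij ik jk.
pose g a (s : store) := upd (upd s j (a :: s j)) k (a :: s k).
have Hb a s' : exec (Seq (Push j a) (Push k a)) s' 5 (g a s').
  apply: (ExecSeq (ExecPush j a s')).
  have := ExecPush k a (upd s' j (a :: s' j)).
  by rewrite /g [upd s' j _ k]/upd eq_sym (negbTE jk).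
have Hg a s' w : g a (upd s' i w) = upd (g a s') i w.
  rewrite /g (upd_comm _ _ _ ij) (upd_comm _ _ _ ik).
  by rewrite ![upd s' i w _]/upd ![_ == i]eq_sym (negbTE ij) (negbTE ik).
have := runs_drain s Hb Hg.
congr (runs _ _ _ _).
have -> : s j = upd s i [::] j by rewrite /upd eq_sym (negbTE ij).
have -> : s k = upd s i [::] k by rewrite /upd eq_sym (negbTE ik).
elim: (s i) (upd s i [::]) => [|a w IH] t /=; first by rewrite !upd_id.
rewrite IH /g rev_cons !cat_rcons upd_same.
rewrite [upd _ k _ j]/upd (negbTE jk) upd_same.
store_cases.
Qed.

Definition double (w : seq bool) : seq bool := flatten [seq [:: true; b] | b <- w].

(** The marker [true] is pushed after its bit, hence ends up in front of it. A register holding a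
    reversed word is thereby encoded in the right order. *)
Lemma runs_encode i j s : i != j ->
  runs (drain i (fun a => Seq (Push j a) (Push j true))) s (size (s i) * 11).+1
    (upd (upd s i [::]) j (double (rev (s i)) ++ s j)).
Proof.
move=> ij.
pose g a (s : store) := upd s j [:: true, a & s j].
have Hb a s' : exec (Seq (Push j a) (Push j true)) s' 5 (g a s').
  apply: (ExecSeq (ExecPush j a s')).
  by have := ExecPush j true (upd s' j (a :: s' j)); rewrite updK upd_same.
have Hg a s' w : g a (upd s' i w) = upd (g a s') i w.
  by rewrite /g (upd_comm _ _ _ ij) /upd eq_sym (negbTE ij).
have := runs_drain s Hb Hg.
congr (runs _ _ _ _).
have -> : s j = upd s i [::] j by rewrite /upd eq_sym (negbTE ij).
elim: (s i) (upd s i [::]) => [|a w IH] t /=; first by rewrite upd_id.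
by rewrite IH /g updK upd_same rev_cons /double map_rcons flatten_rcons -catA.
Qed.

Definition clear (i : nat) : prog := While i isSome (Pop i).

Lemma runs_clear i s : runs (clear i) s (size (s i) * 3).+1 (upd s i [::]).
Proof.
exists (size (s i) * 3).+1 => //.
move E: (s i) => w; elim: w s E => [|a w IH] s E.
  have -> : upd s i [::] = s by rewrite -E upd_id.
  by apply: ExecStop; rewrite E.
have -> : (size (a :: w) * 3).+1 = 1.+1 + (size w * 3).+2 by rewrite /=; lia.
have H1 : exec (Pop i) s 1 (upd s i w) by have := ExecPop i s; rewrite E.
apply: ExecLoop H1 _; first by rewrite E.
by have := IH (upd s i w); rewrite upd_same updK; apply.
Qed.

Definition spair (u v : seq bool) : seq bool := encode1 u ++ v.

Lemma spairE u v : spair u v = double u ++ false :: v.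
Proof. by rewrite /spair /encode1 cat_rcons. Qed.

Lemma size_double w : size (double w) = (size w).*2.
Proof. by elim: w => //= b w ->; rewrite doubleS. Qed.

Lemma size_spair u v : size (spair u v) = (size u).*2 + (size v).+1.
Proof. by rewrite spairE size_cat size_double. Qed.

Lemma poly_fun_pair f g : poly_fun f -> poly_fun g ->
  poly_fun (fun x => spair (f x) (g x)).
Proof.
move=> /poly_funP[p [P [W1 [S1 H1]]]] /poly_funP[q [Q [W2 [S2 H2]]]].
pose K := maxn (width p) (width q).
have [pK qK K0] : [/\ width p <= K, width q <= K & 0 < K] by rewrite /K; split; lia.
pose st a b c d := upd (upd (upd (upd (fun=> [::]) 0 a) K b) K.+1 c) K.+2 d.
have st0 a b c d : st a b c d 0 = a by rewrite /st /upd; repeat (case: eqP => ?); try done; lia.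
have stK a b c d : st a b c d K = b by rewrite /st /upd; repeat (case: eqP => ?); try done; lia.
have stK1 a b c d : st a b c d K.+1 = c by rewrite /st /upd; repeat (case: eqP => ?); try done; lia.
have stK2 a b c d : st a b c d K.+2 = d by rewrite /st /upd; repeat (case: eqP => ?); try done; lia.
have stW a b c d i : 0 < i -> i < K -> st a b c d i = [::].
  by move=> ? ?; rewrite /st /upd; repeat (case: eqP => ?); try done; lia.
pose prg := Seq (drain 0 (Push K)) (Seq (drain K (fun a => Seq (Push 0 a) (Push K.+1 a)))
  (Seq p (Seq (drain 0 (Push K)) (Seq (drain K.+1 (Push K.+2)) (Seq (drain K.+2 (Push 0))
  (Seq q (Seq (Push 0 false) (drain K (fun a => Seq (Push 0 a) (Push 0 true)))))))))).
apply: (@poly_funI prg _ (fun n => 100 * (n + P.[n]%R + Q.[n]%R) + 100)); first by pbound.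
move=> x; have Sf := S1 x.
have R1 : runs (drain 0 (Push K)) (input_store x) (size x * 8).+1 (st [::] (rev x) [::] [::]).
  have := @runs_move 0 K (input_store x); rewrite input_store0.
  have -> : st [::] (rev x) [::] [::] = upd (upd (input_store x) 0 [::]) K (rev x ++ input_store x K).
    rewrite [input_store x K]/input_store /upd; case: eqP; first by lia.
    by rewrite cats0 => _; rewrite /st; store_cases.
  by apply; lia.
have R2 : runs (drain K (fun a => Seq (Push 0 a) (Push K.+1 a))) (st [::] (rev x) [::] [::])
     (size x * 11).+1 (st x [::] x [::]).
  have := @runs_copy K 0 K.+1 (st [::] (rev x) [::] [::]).
  rewrite stK st0 stK1 size_rev revK cats0 (_ : upd _ _ _ = st x [::] x [::]); last by rewrite /st; store_cases.
  by apply; lia.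
have R3 : runs p (st x [::] x [::]) P.[size x]%R (st (f x) [::] x [::]).
  by apply: (runs_fun H1 pK) => [|? ? ?|]; [rewrite st0 | rewrite stW | rewrite /st; store_cases].
have R4 : runs (drain 0 (Push K)) (st (f x) [::] x [::]) (size (f x) * 8).+1
   (st [::] (rev (f x)) x [::]).
  have := @runs_move 0 K (st (f x) [::] x [::]); rewrite st0 stK cats0.
  rewrite (_ : upd _ _ _ = (st [::] (rev (f x)) x [::])); last by rewrite /st; store_cases.
  by apply; lia.
have R5 : runs (drain K.+1 (Push K.+2)) (st [::] (rev (f x)) x [::]) (size x * 8).+1
   (st [::] (rev (f x)) [::] (rev x)).
  have := @runs_move K.+1 K.+2 (st [::] (rev (f x)) x [::]); rewrite stK1 stK2 cats0.
  rewrite (_ : upd _ _ _ = (st [::] (rev (f x)) [::] (rev x))); last by rewrite /st; store_cases.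
  by apply; lia.
have R6 : runs (drain K.+2 (Push 0)) (st [::] (rev (f x)) [::] (rev x)) (size x * 8).+1
   (st x (rev (f x)) [::] [::]).
  have := @runs_move K.+2 0 (st [::] (rev (f x)) [::] (rev x)); rewrite st0 stK2 size_rev revK cats0.
  rewrite (_ : upd _ _ _ = (st x (rev (f x)) [::] [::])); last by rewrite /st; store_cases.
  by apply; lia.
have R7 : runs q (st x (rev (f x)) [::] [::]) Q.[size x]%R (st (g x) (rev (f x)) [::] [::]).
  by apply: (runs_fun H2 qK) => [|? ? ?|]; [rewrite st0 | rewrite stW | rewrite /st; store_cases].
have R8 : runs (Push 0 false) (st (g x) (rev (f x)) [::] [::]) 2
   (st (false :: g x) (rev (f x)) [::] [::]).
  exists 2 => //; have := ExecPush 0 false (st (g x) (rev (f x)) [::] [::]); rewrite st0.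
  by rewrite (_ : upd _ _ _ = (st (false :: g x) (rev (f x)) [::] [::])); last by rewrite /st; store_cases.
have R9 : runs (drain K (fun a => Seq (Push 0 a) (Push 0 true)))
   (st (false :: g x) (rev (f x)) [::] [::]) (size (f x) * 11).+1 (input_store (spair (f x) (g x))).
  have := @runs_encode K 0 (st (false :: g x) (rev (f x)) [::] [::]).
  rewrite st0 stK size_rev revK -spairE.
  rewrite (_ : upd _ _ _ = input_store (spair (f x) (g x))); last by rewrite /st; store_cases.
  by apply; lia.
have := runs_seq R1 (runs_seq R2 (runs_seq R3 (runs_seq R4 (runs_seq R5 (runs_seq R6
  (runs_seq R7 (runs_seq R8 R9))))))).
by apply: runs_le; lia.
Qed.

(** Total on all strings: reading stops at the first pair position not marked [true], whatever
    follows. Malformed strings get the values that the program [decode] below produces. *)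
Fixpoint unpair (z : seq bool) : seq bool * seq bool :=
  match z with
  | true :: b :: z' => (b :: (unpair z').1, (unpair z').2)
  | _ => ([::], behead z)
  end.

Definition sfst (z : seq bool) : seq bool := (unpair z).1.
Definition ssnd (z : seq bool) : seq bool := (unpair z).2.

Lemma unpairK u v : unpair (spair u v) = (u, v).
Proof. by rewrite spairE; elim: u => //= b u ->. Qed.

Lemma sfst_pair u v : sfst (spair u v) = u.
Proof. by rewrite /sfst unpairK. Qed.

Lemma ssnd_pair u v : ssnd (spair u v) = v.
Proof. by rewrite /ssnd unpairK. Qed.

(** The inner emptiness test covers a malformed string that ends right after a marker. *)
Definition decode_step (j : nat) : prog :=
  Seq (Pop 0)
    (If 0 isSome
       (If 0 (pred1 (Some true)) (Seq (Pop 0) (Push j true)) (Seq (Pop 0) (Push j false)))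
       Skip).

Definition decode (j : nat) : prog :=
  Seq (While 0 (pred1 (Some true)) (decode_step j)) (Pop 0).

Lemma seq_pair_ind (T : Type) (P : seq T -> Prop) :
  P [::] -> (forall a, P [:: a]) -> (forall a b w, P w -> P [:: a, b & w]) ->
  forall w, P w.
Proof.
move=> H0 H1 H2; fix IH 1; case=> [//|a [|b w]]; [exact: H1 | exact/H2/IH].
Qed.

Lemma unpair_size z : (size (sfst z)).*2 + size (ssnd z) <= size z.
Proof.
rewrite /sfst /ssnd; elim/seq_pair_ind: z => //= [[]|[] b w IH] //=.
Qed.

Lemma runs_decode j s : j != 0 ->
  runs (decode j) s (size (s 0) * 20 + 20)
    (upd (upd s 0 (ssnd (s 0))) j (rev (sfst (s 0)) ++ s j)).
Proof.
move=> j0.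
(* [rest z] is what the loop leaves in register 0: the terminator followed by the second component,
   or nothing if the string ends prematurely. *)
pose rest := fix rest (z : seq bool) := 
  match z with true :: b :: z' => rest z' | [:: true] => [::] | _ => z end.
have rest_behead z : (unpair z).2 = behead (rest z).
  by elim/seq_pair_ind: z => [|[]|[] b w] //= ->.
have Hpop (s0 : store) a w : s0 0 = a :: w -> exec (Pop 0) s0 1 (upd s0 0 w).
  by move=> E; have := ExecPop 0 s0; rewrite E.
suff [n le_n Hn] : runs (While 0 (pred1 (Some true)) (decode_step j)) s (size (s 0) * 20 + 18)
    (upd (upd s 0 (rest (s 0))) j (rev (sfst (s 0)) ++ s j)).
  exists (n + 2); first by lia.
  apply: (ExecSeq Hn).
  set s1 := upd (upd s 0 (rest _)) j _.
  have -> : upd (upd s 0 (ssnd (s 0))) j (rev (sfst (s 0)) ++ s j) =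
            upd s1 0 (behead (s1 0)).
    have -> : s1 0 = rest (s 0) by rewrite /s1 /upd eq_sym (negbTE j0).
    rewrite -rest_behead /s1; store_cases.
  exact: ExecPop.
move E: (s 0) => z; elim/seq_pair_ind: z s E => [|[]|[] b w IH] s E.
- exists 1 => //=; rewrite -E !upd_id; apply: ExecStop; by rewrite E.
- exists (4.+1 + 2) => //; apply: (@ExecLoop _ _ _ _ (upd s 0 [::])); first by rewrite E.
    apply: (@ExecSeq _ _ _ (upd s 0 [::]) _ 1 2); first exact: Hpop E.
    apply: ExecIf; rewrite upd_same /=; exact: ExecSkip.
  have -> : upd (upd s 0 (rest [:: true])) j (rev (sfst [:: true]) ++ s j) = upd s 0 [::].
    by apply/funext => i; rewrite /upd; case: eqP => [->|] //=; rewrite (negbTE j0).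
  by apply: ExecStop; rewrite upd_same.
- exists 1 => //=; rewrite -E !upd_id; apply: ExecStop; by rewrite E.
- pose s' := upd (upd s 0 w) j (b :: s j).
  have s'0 : s' 0 = w by rewrite /s' /upd eq_sym (negbTE j0).
  have [n le_n Hn] := IH s' s'0.
  exists (10.+1 + n.+1); first by move: le_n => /=; lia.
  apply: (@ExecLoop _ _ _ _ s'); first by rewrite E.
    apply: (@ExecSeq _ _ _ (upd s 0 (b :: w)) _ 1 8); first exact: Hpop E.
    apply: ExecIf; rewrite upd_same; apply: ExecIf; rewrite upd_same.
    have H1 : exec (Pop 0) (upd s 0 (b :: w)) 1 (upd s 0 w).
      by have := Hpop (upd s 0 (b :: w)) b w; rewrite upd_same updK; apply.
    have H2 := ExecPush j b (upd s 0 w).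
    rewrite [upd s 0 w j]/upd (negbTE j0) in H2.
    by rewrite /s'; case: (b) H1 H2 => H1 H2; apply: ExecSeq H1 H2.
  have -> : upd (upd s 0 (rest [:: true, b & w])) j (rev (sfst [:: true, b & w]) ++ s j)
     = upd (upd s' 0 (rest w)) j (rev (sfst w) ++ s' j); last exact: Hn.
  rewrite /s' upd_same /sfst /= rev_cons cat_rcons.
  store_cases.
- exists 1 => //=; rewrite -E !upd_id; apply: ExecStop; by rewrite E.
Qed.

Lemma poly_fun_fst : poly_fun sfst.
Proof.
pose prg := Seq (decode 1) (Seq (clear 0) (drain 1 (Push 0))).
apply: (@poly_funI prg _ (fun n => 100 * n + 100)); first by pbound.
move=> x; have Sx := unpair_size x.
have R1 := @runs_decode 1 (input_store x) isT; rewrite input_store0 in R1.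
have R2 := @runs_clear 0 (upd (upd (input_store x) 0 (ssnd x)) 1 (rev (sfst x) ++ [::])).
have R3 := @runs_move 1 0 (upd (upd (upd (input_store x) 0 (ssnd x)) 1 (rev (sfst x) ++ [::])) 0 [::]) isT.
have := runs_seq R1 (runs_seq R2 R3).
rewrite (_ : upd _ 0 (rev _ ++ _) = input_store (sfst x)).
  by apply: runs_le; rewrite /upd /= size_cat size_rev /=; lia.
by rewrite /upd /= !cats0 revK; apply/funext => -[|[]].
Qed.

Lemma poly_fun_snd : poly_fun ssnd.
Proof.
pose prg := Seq (decode 1) (clear 1).
apply: (@poly_funI prg _ (fun n => 100 * n + 100)); first by pbound.
move=> x; have Sx := unpair_size x.
have R1 := @runs_decode 1 (input_store x) isT; rewrite input_store0 in R1.
have R2 := @runs_clear 1 (upd (upd (input_store x) 0 (ssnd x)) 1 (rev (sfst x) ++ [::])).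
have := runs_seq R1 R2.
rewrite (_ : upd _ 1 [::] = input_store (ssnd x)).
  by apply: runs_le; rewrite /upd /= size_cat size_rev /=; lia.
by apply/funext => -[|[]].
Qed.

Lemma poly_fun_iter_unary k f T : poly_fun k -> poly_fun f -> poly_bounded T ->
  (forall x j, j <= size (sfst (k x)) ->
     size (iter j f (ssnd (k x))) <= T (size x)) ->
  poly_fun (fun x => iter (size (sfst (k x))) f (ssnd (k x))).
Proof.
move=> /poly_funP[q [Q [W2 [S2 H2]]]] /poly_funP[p [P [W1 [S1 H1]]]] [B HB] HT.
pose K := width p.
pose prg := Seq q (Seq (decode K) (While K isSome (Seq (Pop K) p))).
apply: (@poly_funI prg _ (fun n => 100 * (n + Q.[n]%R) + 100 + (n + Q.[n]%R) * (P.[B.[n]]%R + 10))).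
  by pbound.
move=> x; have R0 : runs q (input_store x) Q.[size x]%R (input_store (k x)).
  apply: (runs_fun H2 (leqnn _)); [exact: input_store0 | by move=> [] |].
  exact: upd_input_store.
move: (S2 x) (HT x) R0; move: (k x) => z Sz' HTz R0.
have Sz := unpair_size z.
have K0 : K != 0 by rewrite -lt0n.
have R1 := @runs_decode K (input_store z) K0; rewrite input_store0 in R1.
pose st c x := upd (input_store x) K c.
have E1 : upd (upd (input_store z) 0 (ssnd z)) K (rev (sfst z) ++ input_store z K) =
  st (rev (sfst z)) (ssnd z).
  by rewrite upd_input_store [input_store z K]/input_store /upd (negbTE K0) cats0.
rewrite E1 in R1.
have st0 c v : st c v 0 = v by rewrite /st /upd eq_sym (negbTE K0).
have stK c v : st c v K = c by rewrite /st upd_same.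
have R2 c v : (forall j, j <= size c -> size (iter j f v) <= B.[size x]%R) ->
  runs (While K isSome (Seq (Pop K) p)) (st c v) (size c * (P.[B.[size x]]%R + 10) + 10)
   (st [::] (iter (size c) f v)).
  elim: c v => [|a c IH] v Hs.
    by exists 1 => //; apply: ExecStop; rewrite stK.
  have [n1 L1 E2] : runs p (st c v) P.[B.[size x]]%R (st c (f v)).
    have -> : st c (f v) = upd (st c v) 0 (f (st c v 0)).
      by rewrite st0 /st upd_comm // upd_input_store.
    apply: H1; first exact: leqnn.
      by rewrite st0; apply: (Hs 0).
    by move=> [|i] // _ lt_iK; rewrite /st /upd ltn_eqF.
  have [n2 L2 E3] : runs (While K isSome (Seq (Pop K) p)) (st c (f v))
     (size c * (P.[B.[size x]]%R + 10) + 10) (st [::] (iter (size c) f (f v))).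
    by apply: IH => j le_j; rewrite -iterSr; apply: Hs.
  exists ((1 + n1.+1).+1 + n2.+1); first by rewrite /= mulSn; lia.
  apply: (@ExecLoop _ _ _ _ (st c (f v))); first by rewrite stK.
    apply: (ExecSeq _ E2).
    by have := ExecPop K (st (a :: c) v); rewrite stK /st updK.
  by rewrite [size _]/= iterSr.
have := fun H => runs_seq R0 (runs_seq R1 (R2 (rev (sfst z)) (ssnd z) H)).
rewrite size_rev => H.
have -> : input_store (iter (size (sfst z)) f (ssnd z)) = st [::] (iter (size (sfst z)) f (ssnd z)).
  by rewrite /st; apply/funext => i; rewrite /upd; case: eqP => // ->; rewrite /input_store /upd (negbTE K0).
apply: runs_le (H _).
  by nia.
by move=> j le_j; apply: leq_trans (HB _); apply: HTz.
Qed.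

Lemma poly_fun_nil : poly_fun (fun=> [::]).
Proof.
apply: (@poly_funI (clear 0) _ (fun n => (n * 3).+1)) => [|x]; first by pbound.
by have := runs_clear 0 (input_store x); rewrite input_store0 upd_input_store.
Qed.

Lemma poly_fun_const w : poly_fun (fun=> w).
Proof.
elim: w => [|b w IH]; first exact: poly_fun_nil.
exact: poly_fun_comp (poly_fun_cons b) IH.
Qed.

Ltac pf_step := first [ assumption | lazymatch goal with
  | |- poly_fun sfst => exact: poly_fun_fst
  | |- poly_fun ssnd => exact: poly_fun_snd
  | |- poly_fun behead => exact: poly_fun_behead
  | |- poly_fun (fun x => x) => exact: poly_fun_id
  | |- poly_fun (fun _ => ?w) => exact: (poly_fun_const w)
  | |- poly_fun (fun x => spair (@?f x) (@?g x)) => apply: (@poly_fun_pair f g)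
  | |- poly_fun (fun x => sfst (@?f x)) => apply: (@poly_fun_comp sfst f poly_fun_fst)
  | |- poly_fun (fun x => ssnd (@?f x)) => apply: (@poly_fun_comp ssnd f poly_fun_snd)
  | |- poly_fun (fun x => behead (@?f x)) =>
      apply: (@poly_fun_comp behead f poly_fun_behead)
  | |- poly_fun (fun x => ?b :: @?f x) =>
      apply: (@poly_fun_comp (cons b) f (poly_fun_cons b))
  end ].
Ltac pf := repeat pf_step.

(** * Polynomial-time tests, unary arithmetic and string operations *)

Definition poly_bool (t : seq bool -> bool) : Prop := poly_fun (fun x => [:: t x]).
(* Natural numbers are represented in unary. *)
Definition poly_nat (a : seq bool -> nat) : Prop := poly_fun (fun x => unary (a x)).

Lemma poly_fun_if t f g : poly_bool t -> poly_fun f -> poly_fun g ->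
  poly_fun (fun x => if t x then f x else g x).
Proof.
move=> Ht Hf Hg.
pose h z := if head false z then f (behead (behead z)) else g (behead (behead z)).
have Hh : poly_fun h.
  by apply: poly_fun_case; [apply: (poly_fun_comp Hf)|apply: (poly_fun_comp Hg)]; pf.
(* The pair starts with the marker 1, the bit [t x] and the terminator 0. Removing the marker
   exposes the test; removing two more bits recovers [x]. *)
apply: (poly_fun_ext (f := fun x => h (behead (spair [:: t x] x)))) => //.
by apply: (poly_fun_comp Hh); pf.
Qed.

Lemma poly_bool_head f : poly_fun f -> poly_bool (fun x => head false (f x)).
Proof.
move=> Hf.
have H := poly_fun_case (poly_fun_const [:: true]) (poly_fun_const [:: false]).
apply: poly_fun_ext (poly_fun_comp H Hf) => x.
by case: (head false (f x)).
Qed.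

Lemma poly_bool_ext t u : t =1 u -> poly_bool t -> poly_bool u.
Proof. by move=> /funext ->. Qed.

Lemma poly_nat_ext a b : a =1 b -> poly_nat a -> poly_nat b.
Proof. by move=> /funext ->. Qed.

Lemma poly_bool_if t u v : poly_bool t -> poly_bool u -> poly_bool v ->
  poly_bool (fun x => if t x then u x else v x).
Proof.
move=> Ht Hu Hv; apply: poly_fun_ext (poly_fun_if Ht Hu Hv) => x.
by case: ifP.
Qed.

Lemma poly_bool_const b : poly_bool (fun=> b).
Proof. exact: poly_fun_const. Qed.

Lemma poly_bool_neg t : poly_bool t -> poly_bool (fun x => ~~ t x).
Proof.
move=> Ht; apply: (poly_bool_ext _
  (poly_bool_if Ht (poly_bool_const false) (poly_bool_const true))) => x.
by case: (t x).
Qed.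

Lemma poly_bool_and t u : poly_bool t -> poly_bool u -> poly_bool (fun x => t x && u x).
Proof.
move=> Ht Hu; apply: (poly_bool_ext _
  (poly_bool_if Ht Hu (poly_bool_const false))) => x.
by case: (t x).
Qed.

Lemma poly_bool_nilp f : poly_fun f -> poly_bool (fun x => nilp (f x)).
Proof.
(* The head of [f x] alone cannot tell an empty string from a leading 0, but its encoding starts
   with a marker exactly when it is nonempty. *)
move=> Hf; apply: (poly_bool_ext (t := fun x => ~~ head false (spair (f x) [::]))).
  by move=> x; rewrite spairE; case: (f x).
by apply/poly_bool_neg/poly_bool_head; pf.
Qed.

(** The body of [poly_fun_iter_unary] sees only its state, so the parameter [x] is carried along as
    the first component of the state. *)
Lemma poly_fun_iter_size s g h T : poly_fun s -> poly_fun g -> poly_fun h ->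
  poly_bounded T ->
  (forall x j, j <= size (g x) ->
     size (iter j (fun st => s (spair x st)) (h x)) <= T (size x)) ->
  poly_fun (fun x => iter (size (g x)) (fun st => s (spair x st)) (h x)).
Proof.
move=> Hs Hg Hh HT Hsize.
pose k x := spair (g x) (spair x (h x)).
pose f z := spair (sfst z) (s z).
have E j x : iter j f (spair x (h x)) = spair x (iter j (fun st => s (spair x st)) (h x)).
  by elim: j => //= j ->; rewrite /f sfst_pair.
have H : poly_fun (fun x => ssnd (iter (size (sfst (k x))) f (ssnd (k x)))).
  apply: (poly_fun_comp poly_fun_snd).
  apply: (@poly_fun_iter_unary k f (fun n => 2 * n + T n + 1)) => [|||x j].
  - by rewrite /k; pf.
  - by rewrite /f; pf.
  - by pbound.
  rewrite /k sfst_pair ssnd_pair E size_spair => /Hsize.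
  by lia.
apply: poly_fun_ext H => x.
by rewrite /k sfst_pair ssnd_pair E ssnd_pair.
Qed.

Lemma poly_fun_iter s n h T : poly_fun s -> poly_nat n -> poly_fun h ->
  poly_bounded T ->
  (forall x j, j <= n x ->
     size (iter j (fun st => s (spair x st)) (h x)) <= T (size x)) ->
  poly_fun (fun x => iter (n x) (fun st => s (spair x st)) (h x)).
Proof.
move=> Hs Hn Hh HT H.
have := @poly_fun_iter_size s (fun x => unary (n x)) h T Hs Hn Hh HT.
have E x : size (unary (n x)) = n x by rewrite size_nseq.
move=> H'; apply: poly_fun_ext (H' _) => [x|x j]; first by rewrite E.
by rewrite E; apply: H.
Qed.

Lemma poly_nat_bound n : poly_nat n -> exists P : {poly nat}, forall x, n x <= P.[size x]%R.
Proof.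
by move=> /poly_fun_size[P HP]; exists P => x; have := HP x; rewrite size_nseq.
Qed.

Lemma poly_nat_size f : poly_fun f -> poly_nat (fun x => size (f x)).
Proof.
move=> Hf; have [P HP] := poly_fun_size Hf.
have E x j : iter j (fun st => true :: ssnd (spair x st)) [::] = unary j.
  by elim: j => //= j ->; rewrite ssnd_pair.
apply: (poly_fun_ext (fun x => E x (size (f x)))).
apply: (@poly_fun_iter_size (fun z => true :: ssnd z) f (fun=> [::]) (fun n => P.[n]%R)).
- by pf.
- by pf.
- by pf.
- by pbound.
- by move=> x j le_j; rewrite E size_nseq (leq_trans le_j).
Qed.

(** One bit is transferred per round, and the pair of remaining and accumulated strings only gets
    shorter. Reversal and concatenation then follow. *)
Lemma poly_fun_catrev f g : poly_fun f -> poly_fun g ->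
  poly_fun (fun x => catrev (f x) (g x)).
Proof.
move=> Hf Hg; have [P HP] := poly_fun_size Hf; have [Q HQ] := poly_fun_size Hg.
pose s z := let st := ssnd z in
  spair (behead (sfst st))
    (if head false (sfst st) then true :: ssnd st else false :: ssnd st).
have sE x b u v : s (spair x (spair (b :: u) v)) = spair u (b :: v).
  by rewrite /s !ssnd_pair sfst_pair; case: b.
have E x u v : iter (size u) (fun st => s (spair x st)) (spair u v) = spair [::] (catrev u v).
  by elim: u v => // b u IH v; rewrite [size _]/= iterSr sE IH.
have H : poly_fun (fun x => ssnd (iter (size (f x)) (fun st => s (spair x st)) (spair (f x) (g x)))).
  apply: (poly_fun_comp poly_fun_snd).
  apply: (@poly_fun_iter_size s f _ (fun n => 2 * P.[n]%R + Q.[n]%R + 1)).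
  - apply: poly_fun_pair; first by pf.
    by apply: poly_fun_if; [apply: poly_bool_head|..]; pf.
  - by pf.
  - by pf.
  - by pbound.
  move=> x j le_j.
  suff H u v : j <= size u -> size (iter j (fun st => s (spair x st)) (spair u v)) <= 2 * size u + size v + 1.
    by apply: leq_trans (H _ _ le_j) _; have := HP x; have := HQ x; lia.
  elim: j u v {le_j} => [|j IH] u v; first by rewrite /= size_spair; lia.
  case: u => // b u; rewrite ltnS => /IH {}IH.
  by rewrite iterSr sE; apply: leq_trans (IH _) _; rewrite /=; lia.
by apply: poly_fun_ext H => x; rewrite E ssnd_pair.
Qed.

Lemma poly_fun_rev f : poly_fun f -> poly_fun (fun x => rev (f x)).
Proof. by move=> Hf; apply: poly_fun_catrev; pf. Qed.

Lemma poly_fun_cat f g : poly_fun f -> poly_fun g -> poly_fun (fun x => f x ++ g x).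
Proof.
move=> Hf Hg; apply: (poly_fun_ext _ (poly_fun_catrev (poly_fun_rev Hf) Hg)) => x.
by rewrite catrevE revK.
Qed.

Lemma poly_fun_drop n f : poly_nat n -> poly_fun f -> poly_fun (fun x => drop (n x) (f x)).
Proof.
move=> Hn Hf; have [P HP] := poly_fun_size Hf.
have E x j w : iter j (fun st => behead (ssnd (spair x st))) w = drop j w.
  elim: j w => [|j IH] w; first by rewrite drop0.
  by rewrite iterSr ssnd_pair IH; case: w => //; case: (j).
apply: (poly_fun_ext (fun x => E x (n x) (f x))).
apply: (@poly_fun_iter (fun z => behead (ssnd z)) n f (fun n => P.[n]%R)).
- by pf.
- by [].
- by pf.
- by pbound.
- by move=> x j le_j; rewrite E size_drop; have := HP x; lia.
Qed.

Lemma poly_nat_const c : poly_nat (fun=> c).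
Proof. exact: poly_fun_const. Qed.

Lemma poly_nat_succ a : poly_nat a -> poly_nat (fun x => (a x).+1).
Proof. by move=> Ha; rewrite /poly_nat /=; apply: (poly_fun_comp (poly_fun_cons _)). Qed.

Lemma poly_nat_add a b : poly_nat a -> poly_nat b -> poly_nat (fun x => a x + b x).
Proof.
move=> Ha Hb; apply: poly_fun_ext (poly_fun_cat Ha Hb) => x.
by rewrite /unary nseqD.
Qed.

Lemma poly_nat_sub a b : poly_nat a -> poly_nat b -> poly_nat (fun x => a x - b x).
Proof.
move=> Ha Hb; apply: poly_fun_ext (poly_fun_drop Hb Ha) => x.
by rewrite /unary drop_nseq.
Qed.

Lemma poly_nat_mul a b : poly_nat a -> poly_nat b -> poly_nat (fun x => a x * b x).
Proof.
move=> Ha Hb; have [P HP] := poly_nat_bound Ha; have [Q HQ] := poly_nat_bound Hb.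
have E x j : iter j (fun st => unary (b (sfst (spair x st))) ++ ssnd (spair x st)) [::] = unary (j * b x).
  by elim: j => //= j ->; rewrite sfst_pair ssnd_pair mulSn /unary nseqD.
apply: (poly_fun_ext (fun x => E x (a x))).
apply: (@poly_fun_iter (fun z => unary (b (sfst z)) ++ ssnd z) a _ (fun n => P.[n]%R * Q.[n]%R)).
- apply: poly_fun_cat; last by pf.
  exact: (poly_fun_comp Hb poly_fun_fst).
- by [].
- by pf.
- by pbound.
- move=> x j le_j; rewrite E size_nseq.
  exact: leq_mul (leq_trans le_j (HP x)) (HQ x).
Qed.

Lemma poly_nat_exp a k : poly_nat a -> poly_nat (fun x => a x ^ k).
Proof.
move=> Ha; elim: k => [|k IH]; first exact: poly_nat_const.
by apply: poly_nat_ext (poly_nat_mul Ha IH) => x; rewrite expnS.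
Qed.

Lemma poly_nat_horner (P : {poly nat}) a : poly_nat a -> poly_nat (fun x => P.[a x]%R).
Proof.
move=> Ha; elim/poly_ind: P => [|P c IH].
  by apply: poly_nat_ext (poly_nat_const 0) => x; rewrite horner0.
apply: poly_nat_ext (poly_nat_add (poly_nat_mul IH Ha) (poly_nat_const c)) => x.
by rewrite hornerMXaddC.
Qed.

Lemma poly_fun_take n f : poly_nat n -> poly_fun f -> poly_fun (fun x => take (n x) (f x)).
Proof.
move=> Hn Hf.
have H := poly_fun_rev (poly_fun_drop (poly_nat_sub (poly_nat_size Hf) Hn) (poly_fun_rev Hf)).
apply: poly_fun_ext H => x; rewrite drop_rev revK.
case: (leqP (n x) (size (f x))) => H; first by rewrite subKn.
by rewrite (take_oversize (ltnW H)) take_oversize //; lia.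
Qed.

Lemma poly_bool_leq a b : poly_nat a -> poly_nat b -> poly_bool (fun x => a x <= b x).
Proof.
move=> Ha Hb; apply: poly_bool_ext (poly_bool_nilp (poly_nat_sub Ha Hb)) => x.
by rewrite /nilp size_nseq subn_eq0.
Qed.

Lemma poly_bool_eqn a b : poly_nat a -> poly_nat b -> poly_bool (fun x => a x == b x).
Proof.
move=> Ha Hb; apply: poly_bool_ext (poly_bool_and (poly_bool_leq Ha Hb) (poly_bool_leq Hb Ha)) => x.
by rewrite eqn_leq.
Qed.

Lemma poly_bool_eqb t u : poly_bool t -> poly_bool u -> poly_bool (fun x => t x == u x).
Proof.
move=> Ht Hu; apply: poly_bool_ext (poly_bool_if Ht Hu (poly_bool_neg Hu)) => x.
by case: (t x) (u x) => [] [].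
Qed.

(** Equal leading bits are stripped from both strings until they differ or one is exhausted; the
    strings are equal iff both end up empty. *)
Lemma poly_bool_eq f g : poly_fun f -> poly_fun g -> poly_bool (fun x => f x == g x).
Proof.
move=> Hf Hg; have [P HP] := poly_fun_size Hf; have [Q HQ] := poly_fun_size Hg.
pose t u v := [&& ~~ nilp u, ~~ nilp v & head false u == head false v].
pose s z := let st := ssnd z in let u := sfst st in let v := ssnd st in
  if t u v then spair (behead u) (behead v) else spair u v.
have sE x u v : s (spair x (spair u v)) =
    if t u v then spair (behead u) (behead v) else spair u v.
  by rewrite /s !ssnd_pair sfst_pair.
pose r x j u v := iter j (fun st => s (spair x st)) (spair u v).
have stuck x j u v : t u v = false -> r x j u v = spair u v.
  by move=> tF; elim: j => //= j IH; rewrite /r /= -/(r x j u v) IH sE tF.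
have E x u v : nilp (sfst (r x (size u) u v)) && nilp (ssnd (r x (size u) u v)) = (u == v).
  elim: u v => [|a u IH] v; first by rewrite -[r _ _ _ _]/(spair [::] v) sfst_pair ssnd_pair; case: v.
  case T: (t (a :: u) v); last first.
    rewrite stuck // sfst_pair ssnd_pair /=.
    by case: v T => [|b v] //; rewrite /t /= eqseq_cons => ->.
  case: v T => [|b v] // T.
  rewrite /r iterSr sE T IH eqseq_cons.
  by move: T; rewrite /t /= => ->.
have H : poly_fun (fun x => r x (size (f x)) (f x) (g x)).
  apply: (@poly_fun_iter_size s f (fun x => spair (f x) (g x)) (fun n => 2 * P.[n]%R + Q.[n]%R + 1)).
  - apply: poly_fun_if; [|by pf|by pf].
    rewrite /t; do 2?apply: poly_bool_and.
    + by apply/poly_bool_neg/poly_bool_nilp; pf.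
    + by apply/poly_bool_neg/poly_bool_nilp; pf.
    + by apply: poly_bool_eqb; apply: poly_bool_head; pf.
  - by pf.
  - by pf.
  - by pbound.
  move=> x j _; apply: (@leq_trans (2 * size (f x) + size (g x) + 1)); last first.
    by have := HP x; have := HQ x; lia.
  elim: j (f x) (g x) => [|j IH] u v; first by rewrite /= size_spair; lia.
  rewrite iterSr sE; case: ifP => _; apply: leq_trans (IH _ _) _ => //.
  by rewrite !size_behead; lia.
apply: poly_bool_ext (fun x => E x (f x) (g x)) _.
by apply: poly_bool_and; apply: poly_bool_nilp; pf.
Qed.

(** * Clocked simulation of Turing machines *)

Ltac poly_step := first [ assumption | lazymatch goal with
  | |- poly_fun (fun x => unary (@?a x)) => change (poly_nat a)
  | |- poly_fun (fun x => [:: @?t x]) => change (poly_bool t)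
  | |- poly_fun (fun x => if _ then _ else _) => apply: poly_fun_if
  | |- poly_fun (fun x => @?f x ++ @?g x) => apply: (@poly_fun_cat f g)
  | |- poly_fun (fun x => rev (@?f x)) => apply: (@poly_fun_rev f)
  | |- poly_fun (fun x => take (@?n x) (@?f x)) => apply: (@poly_fun_take n f)
  | |- poly_fun (fun x => drop (@?n x) (@?f x)) => apply: (@poly_fun_drop n f)
  | |- poly_nat (fun _ => ?n) => exact: (poly_nat_const n)
  | |- poly_nat (fun x => size (@?f x)) => apply: (@poly_nat_size f)
  | |- poly_nat (fun x => @?a x + @?b x) => apply: (@poly_nat_add a b)
  | |- poly_nat (fun x => @?a x - @?b x) => apply: (@poly_nat_sub a b)
  | |- poly_nat (fun x => @?a x * @?b x) => apply: (@poly_nat_mul a b)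
  | |- poly_nat (fun x => @?a x ^ ?k) => apply: (@poly_nat_exp a k)
  | |- poly_nat (fun x => (@?a x).+1) => apply: (@poly_nat_succ a)
  | |- poly_nat (fun x => (?P).[@?a x]%R) => apply: (@poly_nat_horner P a)
  | |- poly_bool (fun x => head false (@?f x)) => apply: (@poly_bool_head f)
  | |- poly_bool (fun x => nilp (@?f x)) => apply: (@poly_bool_nilp f)
  | |- poly_bool (fun x => ~~ (@?t x)) => apply: (@poly_bool_neg t)
  | |- poly_bool (fun x => @?t x && @?u x) => apply: (@poly_bool_and t u)
  | |- poly_bool (fun x => @?a x <= @?b x) => apply: (@poly_bool_leq a b)
  | |- poly_bool (fun x => @eq_op _ (@?f x) (@?g x)) =>
      first [apply: (@poly_bool_eqn f g) | apply: (@poly_bool_eq f g)]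
  | _ => pf_step
  end ].
Ltac poly := repeat poly_step.

(* Lists of strings are thus nested pairs, ending with the empty string. *)
Lemma spair_encode u l : spair u (encode l) = encode (u :: l).
Proof. by []. Qed.

Lemma poly_fun_encode (I : Type) (f : I -> seq bool -> seq bool) (s : seq I) :
  (forall i, poly_fun (f i)) -> poly_fun (fun x => encode [seq f i x | i <- s]).
Proof.
move=> Hf; elim: s => [|i s IH]; first exact: poly_fun_const.
exact: poly_fun_pair (Hf i) IH.
Qed.

(** * Polynomial-time functions with values in a finite type *)

Section FiniteValued.
Implicit Types X Y : finType.

Definition code X (x : X) : seq bool := unary (enum_rank x).

Lemma code_inj X : injective (@code X).
Proof.
move=> x y /(congr1 size); rewrite !size_nseq => E.
by apply/enum_rank_inj/val_inj.
Qed.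

Definition poly_fin X (k : seq bool -> X) : Prop := poly_fun (fun z => code (k z)).

Lemma poly_fin_const X (x : X) : poly_fin (fun=> x).
Proof. exact: poly_fun_const. Qed.

Lemma poly_bool_fin_eq X (k : seq bool -> X) x :
  poly_fin k -> poly_bool (fun z => k z == x).
Proof.
move=> Hk; apply: poly_bool_ext (poly_bool_eq Hk (poly_fun_const (code x))) => z.
by rewrite (inj_eq (@code_inj X)).
Qed.

(** A finite chain of equality tests over the elements of [X]. Thanks to it, an arbitrary transition
    table is computable. *)
Lemma poly_fun_switch X (k : seq bool -> X) (g : X -> seq bool -> seq bool) :
  poly_fin k -> (forall x, poly_fun (g x)) -> poly_fun (fun z => g (k z) z).
Proof.
move=> Hk Hg.
suff H (s : seq X) : poly_fun (fun z => if k z \in s then g (k z) z else [::]).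
  by apply: poly_fun_ext (H (enum X)) => z; rewrite mem_enum.
elim: s => [|x s IH]; first exact: poly_fun_const.
apply: poly_fun_ext (poly_fun_if (poly_bool_fin_eq x Hk) (Hg x) IH) => z.
by rewrite inE; case: eqP => [->|].
Qed.

Lemma poly_fin_switch X Y (k : seq bool -> X) (g : X -> seq bool -> Y) :
  poly_fin k -> (forall x, poly_fin (g x)) -> poly_fin (fun z => g (k z) z).
Proof. by move=> Hk Hg; apply: (poly_fun_switch (g := fun x z => code (g x z)) Hk). Qed.

Lemma poly_fin_comp X Y (h : X -> Y) k : poly_fin k -> poly_fin (fun z => h (k z)).
Proof.
move=> Hk; apply: (poly_fin_switch (g := fun x _ => h x) Hk) => x.
exact: poly_fin_const.
Qed.

Lemma poly_fin_comp2 X1 X2 Y (h : X1 -> X2 -> Y) k1 k2 :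
  poly_fin k1 -> poly_fin k2 -> poly_fin (fun z => h (k1 z) (k2 z)).
Proof.
move=> H1 H2; apply: (poly_fin_switch (g := fun x z => h x (k2 z)) H1) => x.
exact: poly_fin_comp.
Qed.

Lemma poly_fin_bool (t : seq bool -> bool) : poly_bool t -> poly_fin t.
Proof.
move=> Ht.
apply: poly_fun_ext (poly_fun_if Ht (poly_fin_const true) (poly_fin_const false)) => z.
by case: (t z).
Qed.

Lemma poly_bool_fin (t : seq bool -> bool) : poly_fin t -> poly_bool t.
Proof.
by move=> /(poly_bool_fin_eq true); apply: poly_bool_ext => z; rewrite eqb_id.
Qed.

Lemma poly_fin_nth X (x0 : X) s f :
  poly_fun f -> poly_fin (fun z => nth x0 s (size (f z))).
Proof.
elim: s f => [|x s IH] f Hf.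
  by apply: poly_fun_ext (poly_fin_const x0) => z; rewrite nth_nil.
have H := IH _ (poly_fun_comp poly_fun_behead Hf).
apply: poly_fun_ext (poly_fun_if (poly_bool_nilp Hf) (poly_fin_const x) H) => z.
by case: (f z).
Qed.

(** The finite function is assembled one argument at a time, starting from the constant filler [x0];
    each update is a binary map between finite types. *)
Lemma poly_fin_ffun (I X : finType) (x0 : X) (k : I -> seq bool -> X) :
  (forall i, poly_fin (k i)) -> poly_fin (fun z => [ffun i => k i z]).
Proof.
move=> Hk.
pose v (s : seq I) z := [ffun i => if i \in s then k i z else x0].
suff H s : poly_fin (v s).
  apply: poly_fun_ext (H (enum I)) => z; congr code.
  by apply/ffunP => i; rewrite !ffunE mem_enum.
elim: s => [|i s IH].
  by apply: poly_fun_ext (poly_fin_const [ffun=> x0]) => z; congr code; apply/ffunP => i; rewrite !ffunE.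
have := poly_fin_comp2 (fun x (u : {ffun I -> X}) => [ffun j => if j == i then x else u j])
   (Hk i) IH.
apply: poly_fun_ext => z; congr code; apply/ffunP => j; rewrite !ffunE inE.
by case: eqP => [->|].
Qed.

End FiniteValued.

(** * Coding of tapes and configurations *)

(** A bit is coded as inside the first component of a pair, and a blank begins like the terminator
    of one, so that [sfst] can read an output. An absent cell is likewise read as a blank. *)
Definition symbol_code (a : symbol) : seq bool :=
  if a is Some b then [:: true; b] else [:: false; false].

Definition symbols_code (s : seq symbol) : seq bool := flatten (map symbol_code s).

Definition head_symbol (w : seq bool) : option bool :=
  if head false w then Some (head false (behead w)) else None.

Lemma head_symbolK s : head_symbol (symbols_code s) = head None s.
Proof. by case: s => [|[b|] s]. Qed.

Lemma behead_symbols_code s :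
  behead (behead (symbols_code s)) = symbols_code (behead s).
Proof. by case: s => [|[b|] s]. Qed.

Lemma size_symbols_code s : size (symbols_code s) = 2 * size s.
Proof. by elim: s => // -[b|] s /= ->; lia. Qed.

(* Decoding a pair stops at the code of the first blank. *)
Lemma sfst_symbols_code s : sfst (symbols_code s) = bits s.
Proof. by rewrite /sfst; elim: s => [|[b|] s IH] //=; rewrite IH. Qed.

Lemma poly_fin_head_symbol f : poly_fun f -> poly_fin (fun z => head_symbol (f z)).
Proof.
move=> Hf.
apply: (poly_fin_comp2 (fun b1 b2 : bool => if b1 then Some b2 else None));
  by apply: poly_fin_bool; poly.
Qed.

Definition tape_code (T : tape) : seq bool :=
  spair (symbols_code T.1) (symbols_code T.2).

Definition tape_action (a : symbol) (d : move) (t : seq bool) : seq bool :=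
  let l := sfst t in
  let r := symbol_code a ++ behead (behead (ssnd t)) in
  match d with
  | Left => spair (behead (behead l)) (symbol_code (head_symbol l) ++ r)
  | Stay => spair l r
  | Right => spair (symbol_code a ++ l) (behead (behead (ssnd t)))
  end.

Lemma tape_actionK a d T :
  tape_action a d (tape_code T) = tape_code (shift_head d (write a T)).
Proof.
case: T => l r; rewrite /tape_action /tape_code sfst_pair ssnd_pair.
by case: d => /=; rewrite ?head_symbolK !behead_symbols_code.
Qed.

Lemma poly_fun_tape_action a d : poly_fun (tape_action a d).
Proof.
case: d; rewrite /tape_action; [|by poly|by poly].
apply: (poly_fun_switch (X := option bool) (k := fun t => head_symbol (sfst t))
  (g := fun s t => spair (behead (behead (sfst t)))
     (symbol_code s ++ symbol_code a ++ behead (behead (ssnd t))))).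
  by apply: poly_fin_head_symbol; poly.
by move=> s; poly.
Qed.

Section Simulation.
Variable M : machine.
Let K := extra_tapes M.

Definition config_code (C : config M) : seq bool :=
  spair (code C.1) (encode [seq tape_code (C.2 i) | i <- enum 'I_K.+1]).

Definition state_of (z : seq bool) : state M :=
  nth (start M) (enum (state M)) (size (sfst z)).

Definition tape_of (i : 'I_K.+1) (z : seq bool) : seq bool := sfst (iter i.+1 ssnd z).

Lemma state_of_code C : state_of (config_code C) = C.1.
Proof. by rewrite /state_of sfst_pair size_nseq nth_enum_rank. Qed.

Lemma tape_of_code i C : tape_of i (config_code C) = tape_code (C.2 i).
Proof.
rewrite /tape_of iterSr ssnd_pair.
have E j l : iter j ssnd (encode l) = encode (drop j l).
  elim: j l => [|j IH] l; first by rewrite drop0.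
  rewrite iterSr; case: l => [|u l]; last by rewrite -spair_encode ssnd_pair IH.
  by rewrite -[ssnd _]/(encode [::]) IH; case: (j).
rewrite E.
have lt_i : i < size [seq tape_code (C.2 i) | i <- enum 'I_K.+1].
  by rewrite size_map size_enum_ord.
rewrite (drop_nth [::] lt_i) -spair_encode sfst_pair.
by rewrite (nth_map i) ?size_enum_ord // nth_ord_enum.
Qed.

Definition scan_of (z : seq bool) : {ffun 'I_K.+1 -> option bool} :=
  [ffun i => head_symbol (ssnd (tape_of i z))].

Definition step_code (z : seq bool) : seq bool :=
  if verdict (state_of z) is Some _ then z
  else let: (s, acts) := delta (state_of z) (scan_of z) in
    spair (code s)
      (encode [seq tape_action (acts i).1 (acts i).2 (tape_of i z) | i <- enum 'I_K.+1]).

Lemma step_codeK C : step_code (config_code C) = config_code (step C).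
Proof.
rewrite /step_code state_of_code /step; case: (verdict C.1) => //.
have -> : scan_of (config_code C) = [ffun i => scan (C.2 i)].
  by apply/ffunP => i; rewrite !ffunE tape_of_code ssnd_pair head_symbolK.
case: (delta _ _) => s acts; congr (spair _ (encode _)).
by apply: eq_map => i; rewrite tape_of_code tape_actionK ffunE.
Qed.

Lemma poly_fin_state_of f : poly_fun f -> poly_fin (fun z => state_of (f z)).
Proof. by move=> Hf; apply: (@poly_fin_nth _ (start M) _ (fun z => sfst (f z))); pf. Qed.

Lemma poly_fun_tape_of i : poly_fun (tape_of i).
Proof.
rewrite /tape_of; apply: (@poly_fun_comp sfst); first exact: poly_fun_fst.
by elim: (i.+1) => [|j IH]; [exact: poly_fun_id | exact: poly_fun_comp poly_fun_snd IH].
Qed.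

(** The state and the scanned symbols range over a finite type, and once they are fixed a step is a
    fixed local change of each tape. *)
Lemma poly_fun_step_code : poly_fun step_code.
Proof.
pose g (sv : state M * {ffun 'I_K.+1 -> option bool}) z :=
  if verdict sv.1 is Some _ then z
  else let: (s, acts) := delta sv.1 sv.2 in
    spair (code s)
      (encode [seq tape_action (acts i).1 (acts i).2 (tape_of i z) | i <- enum 'I_K.+1]).
apply: (@poly_fun_switch _ (fun z => (state_of z, scan_of z)) g).
  apply: poly_fin_comp2; first exact: poly_fin_state_of poly_fun_id.
  apply: (poly_fin_ffun None) => i; apply: poly_fin_head_symbol.
  by apply: (poly_fun_comp poly_fun_snd); apply: poly_fun_tape_of.
move=> [s v]; rewrite /g /=; case: (verdict s) => [_|]; first exact: poly_fun_id.
case: (delta s v) => s' acts; apply: poly_fun_pair; first exact: poly_fun_const.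
apply: (@poly_fun_encode _ (fun i z => tape_action (acts i).1 (acts i).2 (tape_of i z))) => i.
exact: poly_fun_comp (poly_fun_tape_action _ _) (poly_fun_tape_of i).
Qed.

Lemma poly_fun_initial f : poly_fun f -> poly_fun (fun x => config_code (initial M (f x))).
Proof.
move=> Hf; rewrite /config_code; apply: poly_fun_pair.
  exact: (poly_fun_const (code (start M))).
apply: (@poly_fun_encode _ (fun i x => tape_code ((initial M (f x)).2 i))) => i.
rewrite /initial /=; case E: (i == ord0); last first.
  apply: (poly_fun_ext (f := fun=> tape_code ([::], [::]))); last exact: poly_fun_const.
  by move=> x; rewrite ffunE E.
(* The code of an input tape is the encoding of [f x] without its terminator, which is removed by
   reversing, dropping one bit and reversing back. *)
apply: (poly_fun_ext (f := fun x => spair [::] (rev (behead (rev (spair (f x) [::])))))); last by poly.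
move=> x; rewrite ffunE E /tape_code [X in rev (behead (rev X))]spairE cats1 rev_rcons [behead _]/= revK.
congr spair.
by rewrite /symbols_code /double -map_comp.
Qed.

(** Two bits per cell and one pairing bound a tape code by [4 * D + 1]; as a component of a list it
    is doubled and terminated, which gives [8 * D + 3]. *)
Lemma size_config_code (C : config M) D : (forall i, size (C.2 i).1 + size (C.2 i).2 <= D) ->
  size (config_code C) <= 2 * #|state M| + 1 + K.+1 * (8 * D + 3).
Proof.
move=> H; rewrite size_spair size_nseq.
suff : size (encode [seq tape_code (C.2 i) | i <- enum 'I_K.+1]) <= K.+1 * (8 * D + 3).
  move=> Hs; rewrite -addnA; apply: leq_add; first by rewrite mul2n leq_double ltnW.
  by rewrite add1n.
rewrite -[K.+1 in leqRHS]size_enum_ord; elim: (enum _) => //= i s IH.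
rewrite -spair_encode size_spair mulSn.
have : size (tape_code (C.2 i)) <= 4 * D + 1.
  by rewrite size_spair !size_symbols_code; have := H i; lia.
by lia.
Qed.

(** A step creates at most two stored cells: the one written, if nothing was stored under the head,
    and the one entered by the move. *)
Lemma size_iter_step w j i : let C := iter j (@step M) (initial M w) in
  size (C.2 i).1 + size (C.2 i).2 <= size w + 2 * j.
Proof.
elim: j => [|j IH] /=.
  by rewrite ffunE; case: eqP => _ //=; rewrite size_map; lia.
move: IH; move: (iter j _ _) => C /= IH; rewrite /step; case: (verdict _) => [_|]; first by lia.
case: (delta _ _) => s acts /=; rewrite ffunE; move: IH.
by case: (C.2 i) => l r /=; case: (acts i).2 => /=; rewrite ?size_behead; lia.
Qed.

(** The leading [true] distinguishes an accepting run with empty output from a failure. *)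
Definition simulate (t : nat) (w : seq bool) : seq bool :=
  let C := iter t (@step M) (initial M w) in
  if verdict C.1 == Some true then true :: output C else [::].

Lemma simulate_computes w t o : computes_within M w t o ->
  simulate t w = if o is Some v then true :: v else [::].
Proof.
rewrite /computes_within /simulate; case: o => [v [-> ->]|->]; first by rewrite eqxx.
by [].
Qed.

Lemma poly_fun_simulate n f : poly_nat n -> poly_fun f ->
  poly_fun (fun x => simulate (n x) (f x)).
Proof.
move=> Hn Hf; have [P HP] := poly_nat_bound Hn; have [Q HQ] := poly_fun_size Hf.
have E x j w : iter j (fun st => step_code (ssnd (spair x st))) (config_code (initial M w)) =
   config_code (iter j (@step M) (initial M w)).
  by elim: j => //= j ->; rewrite ssnd_pair step_codeK.
have H : poly_fun (fun x => config_code (iter (n x) (@step M) (initial M (f x)))).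
  apply: (poly_fun_ext (fun x => E x (n x) (f x))).
  apply: (@poly_fun_iter (fun z => step_code (ssnd z)) n _
    (fun k => 2 * #|state M| + 1 + K.+1 * (8 * (Q.[k]%R + 2 * P.[k]%R) + 3))).
  - exact: poly_fun_comp poly_fun_step_code poly_fun_snd.
  - by [].
  - exact: poly_fun_initial.
  - by pbound.
  move=> x j le_j; rewrite E; apply: size_config_code => i.
  by apply: leq_trans (size_iter_step _ _ _) _; have := HP x; have := HQ x; lia.
pose r z := if verdict (state_of z) == Some true
  then true :: sfst (ssnd (tape_of ord0 z)) else [::].
have Hr : poly_fun r.
  apply: poly_fun_if; [|by poly; exact: poly_fun_tape_of|by poly].
  apply/poly_bool_fin/(poly_fin_comp (fun s : state M => verdict s == Some true)).
  exact: poly_fin_state_of poly_fun_id.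
apply: poly_fun_ext (poly_fun_comp Hr H) => x.
rewrite /r state_of_code tape_of_code ssnd_pair sfst_symbols_code.
by rewrite /simulate /output.
Qed.

End Simulation.

(** Converse of [poly_fun_time]: a given machine is simulated under its own clock, and the
    acceptance flag is dropped. *)
Lemma poly_time_fun F : poly_time F -> poly_fun F.
Proof.
move=> [M [p HM]].
have H : poly_fun (fun x => behead (simulate M p.[size x]%R x)).
  apply: (poly_fun_comp poly_fun_behead).
  by apply: (@poly_fun_simulate M (fun x => p.[size x]%R)); poly.
by apply: poly_fun_ext H => x; rewrite (simulate_computes (HM x)).
Qed.

Definition run_ppt (M : machine) (p : {poly nat}) (u y r : seq bool) : seq bool :=
  simulate M p.[size (encode [:: u; y])]%R (encode [:: u; y; r]).

(** The total map [g] can be called inside larger programs on any arguments. It stays polynomial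
    because it is clocked, and it needs to agree with [G] only when the number of coins is right. *)
Lemma ppt_simulated q G : ppt q G -> exists2 g : seq bool -> seq bool -> seq bool -> seq bool,
  (forall a b d, poly_fun a -> poly_fun b -> poly_fun d ->
     poly_fun (fun x => g (a x) (b x) (d x))) &
  forall n y r, size r = q.[n]%R ->
    g (unary n) y r = if G (unary n) y r is Some v then true :: v else [::].
Proof.
move=> [M [p HM]]; exists (run_ppt M p) => [a b d Ha Hb Hd|n y r Hr]; last first.
  exact: simulate_computes (HM _ _ _ Hr).
apply: (@poly_fun_simulate M (fun x => p.[size (encode [:: a x; b x])]%R)).
  apply: poly_nat_horner; apply: poly_nat_size.
  exact: poly_fun_pair Ha (poly_fun_pair Hb (poly_fun_const [::])).
exact: poly_fun_pair Ha (poly_fun_pair Hb (poly_fun_pair Hd (poly_fun_const [::]))).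
Qed.

(** * The amplified function *)

Lemma tau_mono c m n : m <= n -> tau c m <= tau c n.
Proof. by move=> le_mn; rewrite /tau /copies leq_mul // leq_exp2r. Qed.

Lemma leq_tau c n : n <= tau c n.
Proof. by rewrite /tau /copies; case: n => // n; rewrite leq_pmulr // expn_gt0. Qed.

Lemma block_length_eq c m n : tau c n <= m -> m < tau c n.+1 -> block_length c m = n.
Proof.
move=> le_nm lt_mn; apply/eqP; rewrite eqn_leq; apply/andP; split.
  apply/bigmax_leqP => i le_im; rewrite leqNgt; apply/negP => lt_ni.
  by have := leq_trans (tau_mono c lt_ni) le_im; rewrite leqNgt lt_mn.
have lt_n : n < m.+1 by rewrite ltnS; apply: leq_trans le_nm; apply: leq_tau.
exact: (@leq_bigmax_cond _ (fun i : 'I_m.+1 => tau c i <= m) _ (Ordinal lt_n)).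
Qed.

Lemma block_lengthP c m :
  tau c (block_length c m) <= m /\ m < tau c (block_length c m).+1.
Proof.
suff [n le_nm lt_mn] : exists2 n, tau c n <= m & m < tau c n.+1.
  by rewrite (block_length_eq le_nm lt_mn).
have ex : exists n, m < tau c n.+1 by exists m; apply: leq_tau.
case: (ex_minnP ex) => n lt_mn Hmin; exists n => //.
case: n lt_mn Hmin => [|n] _ Hmin //.
by rewrite leqNgt; apply/negP => /Hmin; rewrite ltnn.
Qed.

Lemma poly_nat_block_length c f : poly_fun f -> poly_nat (fun x => block_length c (size (f x))).
Proof.
move=> Hf.
suff H : poly_nat (fun x => block_length c (size x)) by exact: poly_fun_comp H Hf.
pose s z := if tau c (size (ssnd z)).+1 <= size (sfst z) then true :: ssnd z else ssnd z.
(* Invariant: the counter [b] is admissible, and either it has grown in every round or the next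
   value is already too large. *)
have E x j : exists2 b, iter j (fun st => s (spair x st)) [::] = unary b &
    [/\ b <= j, tau c b <= size x & b = j \/ size x < tau c b.+1].
  elim: j => [|j [b Eb [le_bj le_b H]]]; first by exists 0 => //; split=> //; left.
  rewrite iterS Eb /s sfst_pair ssnd_pair size_nseq; case: leqP => [le_b1|lt_b1].
    exists b.+1 => //; split=> //; case: H => [->|]; first by left.
    by rewrite ltnNge le_b1.
  by exists b => //; split=> //; [exact: leqW | right].
apply: (poly_fun_ext (f := fun x => iter (size x) (fun st => s (spair x st)) [::])).
  move=> x; have [b Eb [le_b1 le_b2 H]] := E x (size x).
  transitivity (unary b); first exact: Eb.
  rewrite (@block_length_eq c (size x) b) //; case: H => // ->.
  (* A counter that grew in all [size x] rounds equals [size x], and its successor is too large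
     since [n <= tau c n]. *)
  exact: leq_tau.
apply: (@poly_fun_iter_size s _ _ (fun n => n)).
- by rewrite /s /tau /copies; poly.
- by poly.
- by poly.
- by pbound.
by move=> x j le_j; have [b -> [le_bj _ _]] := E x j; rewrite size_nseq (leq_trans le_bj).
Qed.

(** The number of blocks is a free parameter, unlike in [blockwise], so that the value can be split
    at any block boundary. *)
Definition blocks (F : seq bool -> seq bool) (n k : nat) (x : seq bool) : seq bool :=
  encode [seq F y | y <- reshape (nseq k n) x].

(** The encoding is self-delimiting, so components are recovered one by one whatever text
    follows. *)
Lemma encode_inj l1 l2 z1 z2 : size l1 = size l2 ->
  encode l1 ++ z1 = encode l2 ++ z2 -> l1 = l2.
Proof.
elim: l1 l2 => [|u l1 IH] [|v l2] // [Es].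
have E w l z : encode (w :: l) ++ z = spair w (encode l ++ z) by rewrite /spair catA.
by rewrite !E => /(congr1 unpair); rewrite !unpairK => -[-> /(IH _ Es) ->].
Qed.

Section Blocks.
Variable F : seq bool -> seq bool.

Lemma blocksS n k x : blocks F n k.+1 x = spair (F (take n x)) (blocks F n k (drop n x)).
Proof. by []. Qed.

Lemma blocks_cat n j k a b : size a = j * n ->
  blocks F n (j + k) (a ++ b) = blocks F n j a ++ blocks F n k b.
Proof.
elim: j a => [|j IH] a; first by move/size0nil => ->.
rewrite mulSn => Ea; rewrite addSn !blocksS.
have le_na : n <= size a by rewrite Ea leq_addr.
rewrite takel_cat //.
have -> : drop n (a ++ b) = drop n a ++ b.
  rewrite drop_cat; case: ltnP => // le_an; have En : size a = n by lia.
  by rewrite En subnn drop0 drop_oversize // En.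
rewrite IH; first by rewrite /spair catA.
by rewrite size_drop Ea; lia.
Qed.

Lemma blocks_prefix n j a b : size a = j * n -> blocks F n j (a ++ b) = blocks F n j a.
Proof. by move=> Ea; rewrite -{1}[j]addn0 blocks_cat // cats0. Qed.

Lemma size_blocks n k x B : (forall y, size y <= size x -> size (F y) <= B) ->
  size (blocks F n k x) <= k * (2 * B + 1).
Proof.
elim: k x => // k IH x HB; rewrite blocksS size_spair mulSn.
have H1 : size (F (take n x)) <= B by apply: HB; rewrite size_take_min geq_minr.
suff : size (blocks F n k (drop n x)) <= k * (2 * B + 1) by lia.
by apply: IH => y le_y; apply: HB; apply: leq_trans le_y _; rewrite size_drop leq_subr.
Qed.

Lemma poly_fun_blocks n k f : poly_fun F -> poly_nat n -> poly_nat k -> poly_fun f ->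
  poly_fun (fun x => blocks F (n x) (k x) (f x)).
Proof.
move=> HF Hn Hk Hf; have [P HP] := poly_fun_size HF.
have [Q HQ] := poly_fun_size Hf; have [R HR] := poly_nat_bound Hk.
pose s z := let r := sfst (ssnd z) in
  spair (drop (n (sfst z)) r) (ssnd (ssnd z) ++ spair (F (take (n (sfst z)) r)) [::]).
have E x j r a : iter j (fun st => s (spair x st)) (spair r a) =
    spair (drop (j * n x) r) (a ++ blocks F (n x) j r).
  elim: j r a => [|j IH] r a; first by rewrite drop0 cats0.
  rewrite iterSr /s !sfst_pair !ssnd_pair sfst_pair IH drop_drop blocksS mulSn addnC.
  by rewrite -catA /spair cats0.
have H : poly_fun (fun x => ssnd (iter (k x) (fun st => s (spair x st)) (spair (f x) [::]))).
  apply: (poly_fun_comp poly_fun_snd).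
  apply: (@poly_fun_iter s k _ (fun m => 2 * Q.[m]%R + 1 + R.[m]%R * (2 * P.[Q.[m]]%R + 1))).
  - rewrite /s; apply: poly_fun_pair.
      by poly; apply: poly_fun_comp Hn poly_fun_fst.
    poly; apply: (poly_fun_comp HF).
    by poly; apply: poly_fun_comp Hn poly_fun_fst.
  - by [].
  - by poly.
  - by pbound.
  move=> x j le_j; rewrite E size_spair cat0s size_drop.
  have := HQ x; have := HR x => H1 H2.
  have : size (blocks F (n x) j (f x)) <= j * (2 * P.[Q.[size x]]%R + 1).
    apply: size_blocks => y le_y; apply: leq_trans (HP y) _.
    by apply: horner_nat_mono; apply: leq_trans H2.
  have : j * (2 * P.[Q.[size x]]%R + 1) <= R.[size x]%R * (2 * P.[Q.[size x]]%R + 1).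
    by rewrite leq_mul // (leq_trans le_j).
  by move: (j * _) (R.[_]%R * _) => u v; lia.
by apply: poly_fun_ext H => x; rewrite E ssnd_pair.
Qed.

Lemma poly_fun_amplify c : poly_fun F -> poly_fun (amplify F c).
Proof.
move=> HF; rewrite /amplify /blockwise.
have Hn := poly_nat_block_length c poly_fun_id.
apply: poly_fun_cat.
  apply: (poly_fun_blocks (n := fun x => block_length c (size x))
   (k := fun x => copies c (block_length c (size x)))
   (f := fun x => take (tau c (block_length c (size x))) x)) => //.
  - by rewrite /copies; poly.
  - by rewrite /tau /copies; poly.
by rewrite /tau /copies; poly.
Qed.

(* The value of [amplify F c] at [x] with its [i]-th component replaced by [y]. *)
Definition hybrid (c n i : nat) (x y : seq bool) : seq bool :=
  blocks F n i x ++ spair y (blocks F n (copies c n - i.+1) (drop (i.+1 * n) x) ++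
    drop (tau c n) x).

(** The left-hand side uses [x0] only through [F x0], which is all an inverter of [F] is given; the
    overwritten block [u] has no influence. *)
Lemma amplify_hybrid c n i a x0 b u :
  block_length c (size (a ++ x0 ++ b)) = n -> i < copies c n ->
  size a = i * n -> size x0 = n -> size u = n ->
  hybrid c n i (a ++ u ++ b) (F x0) = amplify F c (a ++ x0 ++ b).
Proof.
move=> En lt_it Ea Ex Eu.
have Hau : size (a ++ u) = i.+1 * n by rewrite size_cat Ea Eu mulSn addnC.
have Hax : size (a ++ x0) = i.+1 * n by rewrite size_cat Ea Ex mulSn addnC.
have Et : tau c n = i.+1 * n + (copies c n - i.+1) * n.
  by rewrite -mulnDl subnKC // mulnC.
have Hd w : size w = i.+1 * n -> drop (tau c n) (w ++ b) = drop ((copies c n - i.+1) * n) b.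
  by move=> Ew; rewrite Et addnC -drop_drop drop_size_cat.
have [le_tau _] := block_lengthP c (size (a ++ x0 ++ b)); rewrite En in le_tau.
have le_b : (copies c n - i.+1) * n <= size b.
  by move: le_tau; rewrite catA size_cat Hax Et leq_add2l.
rewrite /hybrid blocks_prefix // catA Hd // drop_size_cat //.
rewrite /amplify En catA Hd // /blockwise -/(blocks _ _ _ _).
have -> : take (tau c n) ((a ++ x0) ++ b) =
   a ++ (x0 ++ take ((copies c n - i.+1) * n) b).
  by rewrite take_cat Et Hax ltnNge leq_addr /= addKn catA.
have -> : copies c n = i + (copies c n - i.+1).+1 by lia.
rewrite blocks_cat // blocksS take_size_cat // drop_size_cat //.
rewrite (_ : i + (copies c n - i.+1).+1 - i.+1 = copies c n - i.+1); last by lia.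
rewrite -[in LHS](cat_take_drop ((copies c n - i.+1) * n) b) blocks_prefix ?size_takel //.
by rewrite cat_take_drop -catA /spair -!catA.
Qed.

(** A collision of the amplified function is a collision of [F] in each block: equal lengths give
    the same block length, and the block values can be read off the encoding. *)
Lemma amplify_block c n i w x : size w = size x ->
  block_length c (size x) = n -> i < copies c n -> amplify F c w = amplify F c x ->
  F (take n (drop (i * n) w)) = F (take n (drop (i * n) x)).
Proof.
move=> Es En lt_it; rewrite /amplify Es En /blockwise => E.
have {E} := encode_inj _ E; rewrite !size_map !size_reshape => /(_ erefl) E.
have := congr1 (nth [::] ^~ i) E.
have sz z : i < size (reshape (nseq (copies c n) n) z) by rewrite size_reshape size_nseq.
rewrite !(nth_map [::]) // !nth_reshape nth_nseq lt_it take_nseq ?(ltnW lt_it) //.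
rewrite sumn_nseq mulnC.
have H z : take n (drop (i * n) (take (tau c n) z)) = take n (drop (i * n) z).
  have -> : tau c n = (copies c n - i) * n + i * n.
    by rewrite -mulnDl subnK 1?ltnW // mulnC.
  by rewrite -take_drop take_takel // leq_pmull // subn_gt0.
by rewrite !H.
Qed.

End Blocks.

(** * Bounded search *)

(** The empty string stands for failure, and the result is that of the first successful index below
    [B]. *)
Fixpoint search (T : nat -> seq bool) (B : nat) : seq bool :=
  if B is j.+1 then if nilp (search T j) then T j else search T j else [::].

Lemma search_hit T B j : j < B -> T j <> [::] -> search T B <> [::].
Proof.
elim: B => // B IH; rewrite ltnS leq_eqVlt => /predU1P[->|lt_jB] Hj /=.
  by case: nilP.
by case: nilP => // E; case: (IH lt_jB Hj).
Qed.

Lemma search_ind (P : seq bool -> Prop) T B :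
  P [::] -> (forall j, P (T j)) -> P (search T B).
Proof. by move=> P0 PT; elim: B => //= B IH; case: nilP. Qed.

Lemma poly_fun_search (T : seq bool -> nat -> seq bool) B :
  poly_fun (fun z => T (sfst z) (size (ssnd z))) -> poly_nat B ->
  poly_fun (fun x => search (T x) (B x)).
Proof.
move=> HT HB; have [P HP] := poly_fun_size HT; have [Q HQ] := poly_nat_bound HB.
pose s z := let st := ssnd z in
  spair (true :: sfst st) (if nilp (ssnd st) then T (sfst z) (size (sfst st)) else ssnd st).
have E x j : iter j (fun st => s (spair x st)) (spair [::] [::]) =
    spair (unary j) (search (T x) j).
  by elim: j => //= j ->; rewrite /s !ssnd_pair !sfst_pair size_nseq.
have H : poly_fun (fun x => ssnd (iter (B x) (fun st => s (spair x st)) (spair [::] [::]))).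
  apply: (poly_fun_comp poly_fun_snd).
  apply: (@poly_fun_iter s B _ (fun n => 2 * Q.[n]%R + 1 + P.[2 * n + 1 + Q.[n]%R]%R)).
  - rewrite /s; apply: poly_fun_pair; first by poly.
    apply: poly_fun_if; [by poly| |by poly].
    apply: (poly_fun_ext (f := fun z => (fun u => T (sfst u) (size (ssnd u))) (spair (sfst z) (sfst (ssnd z))))).
      by move=> z /=; rewrite sfst_pair ssnd_pair.
    by apply: (poly_fun_comp HT); poly.
  - by [].
  - by poly.
  - by pbound.
  move=> x j le_j; rewrite E size_spair size_nseq.
  have le_jQ : j <= Q.[size x]%R := leq_trans le_j (HQ x).
  suff : size (search (T x) j) <= P.[2 * size x + 1 + Q.[size x]%R]%R by lia.
  elim: j le_jQ {le_j} => [|j IH] lt_jQ //=; case: nilP => _; last by apply: IH; lia.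
  have := HP (spair x (unary j)); rewrite sfst_pair ssnd_pair size_nseq => H.
  by apply: leq_trans H _; apply: horner_nat_mono; rewrite size_spair size_nseq; lia.
by apply: poly_fun_ext H => x; rewrite E ssnd_pair.
Qed.

(** * The inverter *)

Definition inverts (F : seq bool -> seq bool)
    (G : seq bool -> seq bool -> seq bool -> option (seq bool))
    (n : nat) (x r : seq bool) : bool :=
  omap (auxiliary F) (G (unary n) (F x) r) == Some (unary n, F x).

Lemma invertsP F G n x r :
  reflect (exists2 w, G (unary n) (F x) r = Some w & size w = n /\ F w = F x)
    (inverts F G n x r).
Proof.
rewrite /inverts; apply: (iffP eqP) => [|[w -> [<- Ew]]]; last by rewrite /= /auxiliary Ew.
case: (G _ _ _) => // w [/(congr1 size)]; rewrite !size_nseq => Es Ew.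
by exists w.
Qed.

(** Time polynomial in the whole input is allowed even though coins are not counted: there are
    [Q.[n]] of them, and [n] is at most the length of the encoded pair of [unary n] and [y]. *)
Lemma ppt_poly_fun (Q : {poly nat}) f : poly_fun f ->
  ppt Q (fun u y r => Some (f (encode [:: u; y; r]))).
Proof.
move=> /poly_fun_time[M [p HM]]; exists M, (p \Po ('X + (2%N)%:P * Q + (1%N)%:P))%R.
move=> n y r Hr; apply: computes_within_mono (HM _).
rewrite horner_comp; apply: horner_nat_mono.
rewrite !hornerD hornerM !hornerC hornerX.
set S := size (encode [:: unary n; y]).
have le_nS : n <= S by rewrite /S -!spair_encode !size_spair size_nseq; lia.
have := horner_nat_mono Q le_nS; rewrite -Hr => le_rS.
apply: (@leq_trans (S + 2 * Q.[S]%R + 1)); last exact: leqnn.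
have -> : size (encode [:: unary n; y; r]) = S + 2 * size r + 1.
  by rewrite /S -!spair_encode !size_spair; lia.
by rewrite leq_add2r leq_add2l leq_mul2l.
Qed.

Section Inverter.
Variables (F : seq bool -> seq bool) (c d : nat) (q : {poly nat}).
Variable G : seq bool -> seq bool -> seq bool -> option (seq bool).
Variable g : seq bool -> seq bool -> seq bool -> seq bool.

Definition trial (n : nat) (y : seq bool) (m i : nat) (x r : seq bool) : seq bool :=
  let v := g (unary m) (hybrid F c n i x y) r in
  let w := take n (drop (i * n) (behead v)) in
  if [&& head false v, size w == n & F w == y] then true :: w else [::].

(** This is [tau c n.+1], a strict upper bound on the input lengths whose block length is [n]. *)
Definition max_length (n : nat) : nat := n.+1 ^ c.+2.
Definition chunk (n : nat) : nat := max_length n + q.[max_length n]%R.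
(** At least [n / delta] for [delta = m^-d / 2t], uniformly in the unknown [m], which is bounded by
    [max_length n]. A good block is then missed in all rounds with probability at most
    [exp (- n)]. *)
Definition rounds (n : nat) : nat := 2 * copies c n * max_length n ^ d * n.
Definition coins : {poly nat} :=
  let M := (('X + (1%N)%:P) ^+ c.+2)%R in
  ((2%N)%:P * 'X ^+ c.+1 * M ^+ d * 'X * (M + (q \Po M)))%R.

Lemma coinsE n : coins.[n]%R = rounds n * chunk n.
Proof.
rewrite /coins /rounds /chunk /max_length /copies.
have e (a b : nat) : (a ^+ b)%R = a ^ b by elim: b => // b IH; rewrite GRing.exprS IH expnS.
set M := (('X + _) ^+ c.+2)%R.
have EM : M.[n]%R = n.+1 ^ c.+2 by rewrite horner_exp hornerD hornerX hornerC e -[n.+1]addn1.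
clearbody M; by rewrite !hornerM hornerD horner_comp !horner_exp EM hornerC hornerX !e.
Qed.

(* A chunk of coins holds a string of length [m] and [q.[m]] coins for [G].  It
   is reused for all [m] and [i]: independence is only needed across chunks. *)
Definition guess (n : nat) (y r : seq bool) : seq bool :=
  search (fun k => search (fun m => search (fun i =>
      trial n y m i (take m (take (chunk n) (drop (k * chunk n) r)))
        (take q.[m]%R (drop m (take (chunk n) (drop (k * chunk n) r)))))
    (copies c n)) (max_length n)) (rounds n).

Definition inverter (z : seq bool) : seq bool :=
  behead (guess (size (sfst z)) (sfst (ssnd z)) (sfst (ssnd (ssnd z)))).

Lemma inverter_encode n y r : inverter (encode [:: unary n; y; r]) = behead (guess n y r).
Proof. by rewrite /inverter -!spair_encode ?(sfst_pair, ssnd_pair) size_nseq. Qed.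

Lemma guess_sound n y r : guess n y r = [::] \/
  exists2 w, guess n y r = true :: w & size w = n /\ F w = y.
Proof.
have H m i x r' : trial n y m i x r' = [::] \/
  exists2 w, trial n y m i x r' = true :: w & size w = n /\ F w = y.
  rewrite /trial; case: and3P => [[_ /eqP E1 /eqP E2]|]; last by left.
  by right; eexists; first by [].
pose P v := v = [::] \/ exists2 w, v = true :: w & size w = n /\ F w = y.
rewrite -/(P _) /guess.
by do 3!(apply: search_ind => [|?]; first by left); apply: H.
Qed.

Definition replace_block (n i : nat) (x0 x : seq bool) : seq bool :=
  take (i * n) x ++ x0 ++ drop (i.+1 * n) x.

Hypothesis g_spec : forall n y r, size r = q.[n]%R ->
  g (unary n) y r = if G (unary n) y r is Some v then true :: v else [::].

(** It suffices that one combination of round, length and position succeeds: should the search stop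
    at an earlier one, its answer has been checked as well. *)
Lemma inverter_correct n x0 r k m i :
  size r = rounds n * chunk n -> size x0 = n -> k < rounds n -> block_length c m = n ->
  i < copies c n ->
  let rho := take (chunk n) (drop (k * chunk n) r) in
  inverts (amplify F c) G m (replace_block n i x0 (take m rho)) (take q.[m]%R (drop m rho)) ->
  inverts F (fun u y r => Some (inverter (encode [:: u; y; r]))) n x0 r.
Proof.
move=> Hr Hx0 lt_k Em lt_i rho.
have [le_tm lt_m] := block_lengthP c m; rewrite Em in le_tm lt_m.
have lt_mM : m < max_length n by rewrite /max_length expnS.
have le_it : i.+1 * n <= tau c n by rewrite /tau mulnC leq_mul.
have le_im : i.+1 * n <= m := leq_trans le_it le_tm.
have Hrho : size rho = chunk n.
  rewrite size_takel // size_drop Hr -mulnBl leq_pmull // subn_gt0 //.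
have Hm : size (take m rho) = m.
  by rewrite size_takel // Hrho /chunk (leq_trans (ltnW lt_mM)) // leq_addr.
have Hq : size (take q.[m]%R (drop m rho)) = q.[m]%R.
  rewrite size_takel // size_drop Hrho /chunk leq_subRL; last by lia.
  by apply: leq_add; [exact: ltnW | apply: horner_nat_mono; exact: ltnW].
set x := take m rho in Hm *; set r' := take _ _ in Hq *.
have Hmul : i.+1 * n = i * n + n by rewrite mulSn addnC.
have Hs : size (replace_block n i x0 x) = m.
  by rewrite /replace_block !size_cat size_takel ?size_drop ?Hx0 Hm; lia.
move=> /invertsP[w Gw [sw Fw]].
(* [amplify_hybrid] is applied with [x] cut around its own [i]-th block, which plays the role of the
   overwritten [u]. *)
have Ehyb : hybrid F c n i x (F x0) = amplify F c (replace_block n i x0 x).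
  have Ex : x = take (i * n) x ++ take n (drop (i * n) x) ++ drop (i.+1 * n) x.
    by rewrite Hmul addnC -drop_drop cat_take_drop cat_take_drop.
  rewrite {1}Ex; apply: amplify_hybrid => //; first by rewrite Hs.
    by rewrite size_takel // Hm; lia.
  by rewrite size_takel // size_drop Hm; lia.
have Hw : size (take n (drop (i * n) w)) = n.
  by rewrite size_takel // size_drop sw; lia.
have FE : F (take n (drop (i * n) w)) = F x0.
  rewrite (@amplify_block F c n i w (replace_block n i x0 x)) ?Hs ?sw //.
  rewrite /replace_block drop_cat size_takel ?Hm ?ltnn; last by lia.
  by rewrite subnn drop0 take_cat Hx0 ltnn subnn take0 cats0.
have Ht : trial n (F x0) m i x r' = true :: take n (drop (i * n) w).
  by rewrite /trial Ehyb g_spec // Gw /= Hw FE !eqxx.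
have Hg : guess n (F x0) r <> [::].
  apply: (search_hit lt_k); apply: (search_hit lt_mM); apply: (search_hit lt_i).
  by rewrite -/rho -/x -/r' Ht.
apply/invertsP; exists (behead (guess n (F x0) r)); first by rewrite inverter_encode.
by case: (guess_sound n (F x0) r) => // -[v -> /=].
Qed.

Lemma poly_fun_inverter : poly_fun F ->
  (forall a b e, poly_fun a -> poly_fun b -> poly_fun e ->
     poly_fun (fun x => g (a x) (b x) (e x))) ->
  poly_fun inverter.
Proof.
move=> HF Hg; apply: (poly_fun_comp poly_fun_behead); rewrite /guess.
have Hmax a : poly_nat a -> poly_nat (fun z => max_length (a z)) by move=> Ha; rewrite /max_length; poly.
have Hchunk a : poly_nat a -> poly_nat (fun z => chunk (a z)).
  by move=> Ha; rewrite /chunk; apply: poly_nat_add; [|apply: poly_nat_horner]; apply: Hmax.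
have Hcopies a : poly_nat a -> poly_nat (fun z => copies c (a z)) by move=> Ha; rewrite /copies; poly.
have Htrial n y m i x r : poly_nat n -> poly_fun y -> poly_nat m -> poly_nat i ->
  poly_fun x -> poly_fun r -> poly_fun (fun z => trial (n z) (y z) (m z) (i z) (x z) (r z)).
  move=> Hn Hy Hm Hi Hx Hr; rewrite /trial.
  have Hh : poly_fun (fun z => hybrid F c (n z) (i z) (x z) (y z)).
    rewrite /hybrid; apply: poly_fun_cat; first exact: poly_fun_blocks.
    apply: poly_fun_pair => //; apply: poly_fun_cat; last by rewrite /tau /copies; poly.
    by apply: poly_fun_blocks => //; rewrite ?/copies; poly.
  have Hv := Hg _ _ _ Hm Hh Hr.
  have Hw : poly_fun (fun z => take (n z) (drop (i z * n z) (behead (g (unary (m z))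
     (hybrid F c (n z) (i z) (x z) (y z)) (r z))))) by poly.
  have HFw := poly_fun_comp HF Hw.
  by cbv zeta; poly.
(* At each level of search the counter is paired with the data available so far: the current index
   is the [ssnd], and the original input lies one [sfst] deeper than before. *)
pose T x k := search (fun m => search (fun i =>
      trial (size (sfst x)) (sfst (ssnd x)) m i (take m (take (chunk (size (sfst x)))
       (drop (k * chunk (size (sfst x))) (sfst (ssnd (ssnd x))))))
        (take q.[m]%R (drop m (take (chunk (size (sfst x)))
         (drop (k * chunk (size (sfst x))) (sfst (ssnd (ssnd x))))))))
    (copies c (size (sfst x)))) (max_length (size (sfst x))).
apply: (@poly_fun_search T (fun x => rounds (size (sfst x)))); last first.
  rewrite /rounds; apply: poly_nat_mul; last by poly.
  apply: poly_nat_mul; last by apply: poly_nat_exp; apply: Hmax; poly.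
  by apply: poly_nat_mul; [poly|apply: Hcopies; poly].
rewrite /T.
pose T2 z m := search (fun i =>
      trial (size (sfst (sfst z))) (sfst (ssnd (sfst z))) m i (take m (take (chunk (size (sfst (sfst z))))
       (drop (size (ssnd z) * chunk (size (sfst (sfst z)))) (sfst (ssnd (ssnd (sfst z)))))))
        (take q.[m]%R (drop m (take (chunk (size (sfst (sfst z))))
         (drop (size (ssnd z) * chunk (size (sfst (sfst z)))) (sfst (ssnd (ssnd (sfst z)))))))))
    (copies c (size (sfst (sfst z)))).
apply: (@poly_fun_search T2 (fun z => max_length (size (sfst (sfst z))))); last by apply: Hmax; poly.
rewrite /T2.
pose T3 z i := 
      trial (size (sfst (sfst (sfst z)))) (sfst (ssnd (sfst (sfst z)))) (size (ssnd z)) i (take (size (ssnd z)) (take (chunk (size (sfst (sfst (sfst z)))))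
       (drop (size (ssnd (sfst z)) * chunk (size (sfst (sfst (sfst z))))) (sfst (ssnd (ssnd (sfst (sfst z))))))))
        (take q.[size (ssnd z)]%R (drop (size (ssnd z)) (take (chunk (size (sfst (sfst (sfst z)))))
         (drop (size (ssnd (sfst z)) * chunk (size (sfst (sfst (sfst z))))) (sfst (ssnd (ssnd (sfst (sfst z)))))))))
   .
apply: (@poly_fun_search T3 (fun z => copies c (size (sfst (sfst (sfst z)))))); last by apply: Hcopies; poly.
rewrite /T3.
have Hrho : poly_fun (fun z => take (chunk (size (sfst (sfst (sfst (sfst z))))))
         (drop (size (ssnd (sfst (sfst z))) * chunk (size (sfst (sfst (sfst (sfst z))))))
           (sfst (ssnd (ssnd (sfst (sfst (sfst z)))))))).
  have Hc : poly_nat (fun z => chunk (size (sfst (sfst (sfst (sfst z)))))) by apply: Hchunk; poly.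
  by poly.
by apply: Htrial; poly.
Qed.

End Inverter.

(** * Averages over uniform strings *)

Local Open Scope ring_scope.

Section Average.
Variable R : realType.
Implicit Types f g : seq bool -> R.

(** Expectation over a uniform string of length [n], by recursion on its bits rather than as a sum
    over tuples. Splitting a string or exchanging two averages then becomes a plain induction
    without casts between tuple types. *)
Fixpoint average (n : nat) (f : seq bool -> R) : R :=
  if n is k.+1
  then (average k (fun x => f (true :: x)) + average k (fun x => f (false :: x))) / 2
  else f [::].

Lemma eq_average n f g : (forall x, size x = n -> f x = g x) -> average n f = average n g.
Proof.
elim: n f g => [|n IH] f g H /=; first exact: H.
by congr ((_ + _) / _); apply: IH => x Ex; apply: H; rewrite /= Ex.
Qed.

Lemma ler_average n f g : (forall x, size x = n -> f x <= g x) -> average n f <= average n g.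
Proof.
elim: n f g => [|n IH] f g H /=; first exact: H.
rewrite ler_pM2r ?invr_gt0 ?ltr0n //.
by apply: lerD; apply: IH => x Ex; apply: H; rewrite /= Ex.
Qed.

Lemma averageD n f g : average n (fun x => f x + g x) = average n f + average n g.
Proof. by elim: n f g => //= n IH f g; rewrite !IH; field. Qed.

Lemma averageZ n a f : average n (fun x => a * f x) = a * average n f.
Proof. by elim: n f => //= n IH f; rewrite !IH; field. Qed.

Lemma average_const n a : average n (fun=> a) = a.
Proof. by elim: n => //= n ->; field. Qed.

Lemma average_sum n k (f : nat -> seq bool -> R) :
  average n (fun x => \sum_(i < k) f i x) = \sum_(i < k) average n (f i).
Proof.
elim: k => [|k IH].
  by under eq_average do rewrite big_ord0; rewrite big_ord0 average_const.
by under eq_average do rewrite big_ord_recr /=; rewrite big_ord_recr averageD IH.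
Qed.

Lemma average_cat a b f :
  average (a + b) f = average a (fun x => average b (fun y => f (x ++ y))).
Proof. by elim: a f => //= a IH f; rewrite !IH. Qed.

Lemma average_swap a b (f : seq bool -> seq bool -> R) :
  average a (fun x => average b (fun y => f x y)) =
  average b (fun y => average a (fun x => f x y)).
Proof.
elim: a f => //= a IH f; rewrite !IH -averageD mulrC -averageZ.
by apply: eq_average => x _; rewrite mulrC.
Qed.

Lemma sum_tuple_average n f :
  \sum_(x : n.-tuple bool) f x = 2 ^+ n * average n f.
Proof.
elim: n f => [|n IH] f /=.
  rewrite expr0 mul1r (bigD1 [tuple]) //= big1 ?addr0 // => x.
  by case/eqP; apply: tuple0.
rewrite (reindex (fun p : bool * n.-tuple bool => [tuple of p.1 :: p.2])) /=; last first.
  exists (fun t => (thead t, [tuple of behead t])) => [[b t] _|t _] /=.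
    by rewrite theadE; congr pair; apply: val_inj.
  by apply: val_inj; rewrite /= [t in RHS]tuple_eta.
rewrite -(pair_bigA _ (fun b (t : n.-tuple bool) => f (b :: t))) /=.
by rewrite big_bool /= (IH (fun x => f (true :: x))) (IH (fun x => f (false :: x))) exprS; field.
Qed.

Lemma average_bounds n f a b : (forall x, size x = n -> a <= f x <= b) ->
  a <= average n f <= b.
Proof.
move=> H; rewrite -{1}(average_const n a) -{1}(average_const n b).
by apply/andP; split; apply: ler_average => x /H /andP[].
Qed.

Lemma average_bool n (P : seq bool -> bool) : 0 <= average n (fun x => (P x)%:R) <= 1.
Proof. by apply: average_bounds => x _; rewrite ler0n lern1 leq_b1. Qed.

Lemma average_bool_ge0 n (P : seq bool -> bool) : 0 <= average n (fun x => (P x)%:R).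
Proof. by have /andP[] := average_bool n P. Qed.

Definition block (n i : nat) (x : seq bool) : seq bool := take n (drop (i * n) x).

(** Disjoint blocks of a uniform string are independent; the [l] trailing bits are averaged out. *)
Lemma average_prod n t l (f : nat -> seq bool -> R) :
  average (t * n + l) (fun x => \prod_(i < t) f i (block n i x)) =
  \prod_(i < t) average n (f i).
Proof.
elim: t f => [|t IH] f.
  by under eq_average do rewrite big_ord0; rewrite big_ord0 average_const.
rewrite mulSn -addnA average_cat big_ord_recl -(IH (fun i => f i.+1)) mulrC -averageZ.
apply: eq_average => u Eu; rewrite mulrC -averageZ; apply: eq_average => v _.
rewrite big_ord_recl; congr (_ * _).
  by rewrite /block mul0n drop0 take_size_cat.
apply: eq_bigr => i _; congr (f _ _).
by rewrite /block /= /bump /= add1n mulSn addnC -drop_drop drop_size_cat.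
Qed.

(** Passage from counting pairs of tuples to iterated averages, in which all later estimates are
    made. *)
Lemma inversion_probE F q G n :
  inversion_prob R F q G n =
  average n (fun x => average q.[n] (fun r => (inverts F G n x r)%:R)).
Proof.
rewrite /inversion_prob /finite_uniform card_prod !card_tuple card_bool -sum1_card natr_sum.
rewrite (eq_bigl (fun xr : n.-tuple bool * (q.[n]).-tuple bool => inverts F G n xr.1 xr.2)); last first.
  by move=> xr; rewrite inE.
rewrite big_mkcond /=.
rewrite -(pair_bigA _ (fun (x : n.-tuple bool) (r : (q.[n]).-tuple bool) =>
   if inverts F G n x r then (1%:R : R) else 0)) /=.
under eq_bigr => x _.
  under eq_bigr do rewrite -mulrb.
  rewrite (sum_tuple_average _ (fun r => (inverts F G n x r)%:R)).
  over.
rewrite (sum_tuple_average _ (fun x => 2 ^+ _ * average _ (fun r => (inverts F G n x r)%:R))).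
rewrite averageZ natrM !natrX; field.
by rewrite !expf_neq0 // pnatr_eq0.
Qed.

End Average.

(** * The reduction *)

Section Reduction.
Variable R : realType.

(* The [i]-th block of a uniform string is independent of the other ones, so it
   can be exchanged with a fresh one. *)
Lemma average_replace n i l (f s : seq bool -> R) :
  average (i * n + (n + l)) (fun x => f (block n i x) * s x) =
  average n (fun u => f u *
    average (i * n + (n + l)) (fun x => s (replace_block n i u x))).
Proof.
rewrite average_cat.
under eq_average => a Ea.
  rewrite average_cat.
  under eq_average => u Eu.
    under eq_average do
      rewrite /block drop_size_cat // take_size_cat //.
    rewrite averageZ; over.
  over.
rewrite average_swap; apply: eq_average => u Eu.
rewrite averageZ; congr (_ * _).
rewrite average_cat; apply: eq_average => a Ea.
rewrite average_cat -[LHS](average_const n); apply: eq_average => v Ev.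
apply: eq_average => b Eb; congr s.
rewrite /replace_block take_size_cat // [a ++ v ++ b]catA drop_size_cat //.
by rewrite size_cat Ea Ev mulSn addnC.
Qed.

Section GoodBlock.
Variables (n t m : nat) (s : seq bool -> R) (delta beta : R).
Hypothesis le_tm : (t * n <= m)%N.
Hypothesis s01 : forall x, size x = m -> 0 <= s x <= 1.
Hypothesis delta_ge0 : 0 <= delta.

Definition good (i : nat) (u : seq bool) : bool :=
  delta <= average m (fun x => s (replace_block n i u x)).

Lemma exists_good_block :
  t%:R * delta + (1 - beta) ^+ t < average m s ->
  exists2 i, (i < t)%N & 1 - beta < average n (fun u => (good i u)%:R).
Proof.
move=> lt_s; have [//|noblock] := pselect (exists2 i, (i < t)%N &
  1 - beta < average n (fun u => (good i u)%:R)).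
have few i : (i < t)%N -> average n (fun u => (good i u)%:R) <= 1 - beta.
  by move=> lt_it; rewrite leNgt; apply/negP => H; apply: noblock; exists i.
suff : average m s <= t%:R * delta + (1 - beta) ^+ t by rewrite leNgt lt_s.
pose bad i u : R := (~~ good i u)%:R.
pose all_good x : R := \prod_(i < t) (good i (block n i x))%:R.
(* If some block of [x] is bad, its term in the sum is already [s x]; otherwise the product is 1,
   which bounds [s x]. *)
have le1 : average m s <= average m (fun x =>
    \sum_(i < t) bad i (block n i x) * s x + all_good x).
  apply: ler_average => x /s01/andP[s0 s1].
  have [/existsP[i Hi]|] := boolP [exists i : 'I_t, ~~ good i (block n i x)].
    rewrite (bigD1 i) //= {1}/bad Hi mul1r -addrA lerDl addr_ge0 //.
      by apply: sumr_ge0 => j _; rewrite mulr_ge0 ?ler0n.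
    by apply: prodr_ge0 => j _; rewrite ler0n.
  move/existsPn => H; rewrite /all_good [\prod_(i < t) _]big1 => [|i _]; last first.
    by have := H i; rewrite negbK => ->.
  by rewrite (le_trans s1) // lerDr sumr_ge0 // => j _; rewrite mulr_ge0 ?ler0n.
apply: le_trans le1 _; rewrite averageD.
rewrite (@average_sum _ m t (fun i x => bad i (block n i x) * s x)).
apply: lerD.
  apply: (@le_trans _ _ (\sum_(i < t) delta)); last first.
    by rewrite sumr_const card_ord -[delta *+ _]mulr_natl.
  apply: ler_sum => i _.
  have le_im : (i * n + n <= m)%N.
    by apply: leq_trans le_tm; rewrite addnC -mulSn leq_mul2r ltn_ord orbT.
  (* Averaging over the [i]-th block [u] separately leaves, for a bad [u], the success probability
     with [u] planted, which is below [delta] by definition. *)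
  have Em : m = (i * n + (n + (m - (i * n + n))))%N by lia.
  rewrite [X in average X _]Em average_replace -Em.
  rewrite -[leRHS](average_const n); apply: ler_average => u _.
  rewrite /bad; case: (boolP (good i u)) => /=; first by rewrite mul0r.
  by rewrite -ltNge mul1r => /ltW.
(* By independence, the probability that all blocks are good is the product of the densities, each
   at most [1 - beta]. *)
rewrite (_ : m = (t * n + (m - t * n))%N); last by lia.
rewrite (average_prod _ _ _ (fun i u => (good i u)%:R)).
rewrite -[X in _ ^+ X]card_ord -prodr_const; apply: ler_prod => i _.
rewrite few ?ltn_ord // andbT -[X in X <= _](average_const n).
by apply: ler_average => u _; rewrite ler0n.
Qed.

End GoodBlock.

(** [T] can fail only if [S] fails on each of [N] independent chunks, which has probability the
    [N]-th power of the failure probability of [S]. *)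
Lemma average_repeat (N L : nat) (T S : seq bool -> bool) :
  (forall r k, size r = (N * L)%N -> (k < N)%N -> S (block L k r) -> T r) ->
  1 - (1 - average L (fun r => (S r)%:R)) ^+ N <= average (N * L) (fun r => (T r)%:R) :> R.
Proof.
(* The indicator of failure is written as a linear expression, so that [averageD] and [averageZ]
   apply to it. *)
move=> ST; pose miss r : R := 1 + -1 * (S r)%:R.
have -> : (1 - average L (fun r => (S r)%:R)) ^+ N =
    average (N * L) (fun r => \prod_(i < N) miss (block L i r)).
  rewrite -[(N * L)%N]addn0 (average_prod _ _ _ (fun=> miss)).
  by rewrite prodr_const card_ord averageD averageZ average_const mulN1r.
rewrite -{1}(average_const (N * L) (1 : R)) -mulN1r -averageZ -averageD.
apply: ler_average => r Er.
have [Tr|nTr] := boolP (T r).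
  rewrite mulN1r gerBl prodr_ge0 // => i _.
  by rewrite /miss; case: (S _); rewrite ?mulr1 ?mulr0 ?subrr ?addr0.
rewrite big1 ?mulr1 ?subrr // => i _.
rewrite /miss; case: (boolP (S _)) => [/(ST _ _ Er (ltn_ord i)) Tr|_].
  by rewrite Tr in nTr.
by rewrite mulr0 addr0.
Qed.

Lemma inverter_prob F G g q c d (delta beta : R) m n :
  (forall k y r, size r = q.[k] ->
    g (unary k) y r = if G (unary k) y r is Some v then true :: v else [::]) ->
  block_length c m = n -> 0 <= delta <= 1 ->
  (copies c n)%:R * delta + (1 - beta) ^+ copies c n <
    inversion_prob R (amplify F c) q G m ->
  1 - beta - (1 - delta) ^+ rounds c d n <
    inversion_prob R F (coins c d q)
      (fun u y r => Some (inverter F c d q g (encode [:: u; y; r]))) n.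
Proof.
move=> g_spec En /andP[delta0 delta1]; rewrite !inversion_probE => lt_s.
have [le_tm lt_m] := block_lengthP c m; rewrite En in le_tm lt_m.
pose s x : R := average q.[m] (fun r => (inverts (amplify F c) G m x r)%:R).
have s01 x : size x = m -> 0 <= s x <= 1.
  by move=> _; apply: average_bool.
have le_tm' : (copies c n * n <= m)%N by rewrite mulnC.
have [i lt_i Hgood] := exists_good_block le_tm' s01 delta0 lt_s.
set eta := (1 - delta) ^+ _.
have eta01 : 0 <= eta <= 1.
  by rewrite /eta exprn_ge0 ?exprn_ile1 ?subr_ge0 // lerBlDr lerDl.
have /andP[eta0 eta1] := eta01.
apply: (@lt_le_trans _ _ ((1 - eta) * average n (fun u => (good n m s delta i u)%:R))).
  (* With [p] the density of good blocks, [(1 - eta) * p] is at least [p - eta] because [p <= 1]. *)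
  have : average n (fun u => (good n m s delta i u)%:R) <= 1 :> R.
    by have /andP[] := average_bool R n (good n m s delta i).
  move: Hgood; set p := average _ _; nra.
rewrite -averageZ; apply: ler_average => u Eu.
have [gu|_] := boolP (good n m s delta i u); last first.
  by rewrite mulr0; apply: (@average_bool_ge0 R _ (fun r => inverts F _ n u r)).
rewrite mulr1 coinsE.
pose S rho := inverts (amplify F c) G m (replace_block n i u (take m rho))
  (take q.[m] (drop m rho)).
apply: le_trans (average_repeat (S := S) _); last first.
  move=> r k Er lt_k HS; apply: (inverter_correct g_spec Er Eu lt_k En lt_i HS).
rewrite lerB // /eta lerXn2r ?nnegrE ?subr_ge0 //.
  by have /andP[] := average_bool R (chunk c q n) S.
rewrite lerB //.
(* A round reads only the first [m + q.[m]] bits of its chunk, and these are a uniform input and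
   uniform coins for [G]; the remaining bits average out. *)
suff -> : average (chunk c q n) (fun r => (S r)%:R) =
   average m (fun x => s (replace_block n i u x)) :> R by [].
have Hchunk : chunk c q n = (m + (q.[m] + (chunk c q n - (m + q.[m]))))%N.
  have : (m <= max_length c n)%N by rewrite /max_length expnS ltnW.
  by move=> H; rewrite addnA subnKC // leq_add // horner_nat_mono.
rewrite Hchunk average_cat; apply: eq_average => x Ex.
rewrite average_cat; apply: eq_average => r Er.
rewrite -[RHS](average_const (chunk c q n - (m + q.[m]))).
by apply: eq_average => z _; rewrite /S take_size_cat // drop_size_cat // take_size_cat.
Qed.

End Reduction.

(** * Exponential estimates *)

Lemma expR_dominates (R : realType) (e : nat) :
  exists N : nat, forall n, (N <= n)%N -> 2 * n.+1%:R ^+ e <= expR (n%:R / 2) :> R.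
Proof.
(* With [k = e + 1], [exp (n / 2)] is the [k]-th power of [exp (n / 2k)], hence at least
   [((n + 1) / 2k)^k]. This exceeds [2 (n + 1)^e] as soon as [n + 1] is at least [2 (2k)^k]. *)
pose k := e.+1; exists (2 * (2 * k) ^ k)%N => n le_n.
have k0 : 0 < (2 * k)%:R :> R by rewrite ltr0n.
have -> : n%:R / 2 = k%:R * (n%:R / (2 * k)%:R) :> R.
  by rewrite natrM; field; rewrite pnatr_eq0.
rewrite expRM_natl; apply: (@le_trans _ _ ((n.+1%:R / (2 * k)%:R) ^+ k)); last first.
  apply: lerXn2r; rewrite ?nnegrE ?expR_ge0 ?divr_ge0 //.
  apply: le_trans (expR_ge1Dx _); rewrite -natr1 mulrDl addrC lerD2r mul1r.
  by rewrite invf_le1 // ler1n.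
rewrite expr_div_n ler_pdivlMr ?exprn_gt0 // [n.+1%:R ^+ k]exprS mulrAC.
rewrite ler_pM2r ?exprn_gt0 ?ltr0n //.
by rewrite -natrX -natrM ler_nat leqW.
Qed.

Lemma exprn_le_expR (R : realType) (x : R) (N : nat) :
  x <= 1 -> (1 - x) ^+ N <= expR (- (N%:R * x)).
Proof.
move=> x1; rewrite -mulrN expRM_natl; apply: lerXn2r; rewrite ?nnegrE ?expR_ge0 ?subr_ge0 //.
exact: expR_ge1Dx.
Qed.

Unset Implicit Arguments.

Theorem theorem5p1 (R : realType) (F : seq bool -> seq bool) (c : nat) :
  weakly_one_way R F ->
  (0 < c)%N ->
  (forall (q : {poly nat})
          (G : seq bool -> seq bool -> seq bool -> option (seq bool)),
     ppt q G ->
     \forall n \near \oo%classic,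
       inversion_prob R F q G n <= 1 - n%:R `^ (- c%:R)) ->
  strongly_one_way R (amplify F c).
Proof.
move=> [/poly_time_fun HF _] _ weak; split; first exact/poly_fun_time/poly_fun_amplify.
move=> C C_gt0 q G /ppt_simulated[g g_poly g_spec].
(* An integer exponent above [C]: since [m^-d <= m^-C], it is enough to refute success above
   [m^-d]. *)
pose d := Num.bound C; have lt_Cd : C < d%:R by apply/archi_boundP/ltW.
(* The inverter depends on [d] and on the adversary but not on [m], so a single threshold [n0]
   serves all input lengths. *)
have [n0 _ H0] := weak _ _ (ppt_poly_fun (coins c d q) (poly_fun_inverter c d q HF g_poly)).
have [n1 H1] := expR_dominates R (c.+2 * d).
have [n2 H2] := expR_dominates R c.
(* From this length on, the block length exceeds all three thresholds. *)
exists (tau c (n0 + n1 + n2).+1) => // m /= le_m.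
have [le_tm lt_mt] := block_lengthP c m.
set n := block_length c m in le_tm lt_mt.
have lt_n : (n0 + n1 + n2 < n)%N.
  rewrite ltnNge; apply/negP => le_n.
  have := leq_trans lt_mt (leq_trans (tau_mono c (le_n : n.+1 <= _.+1)%N) le_m).
  by rewrite ltnn.
have [le_n0 le_n1 le_n2] : [/\ n0 <= n, n1 <= n & n2 <= n]%N.
  split; apply: leq_trans (ltnW lt_n); last exact: leq_addl.
    by rewrite -addnA leq_addr.
  by rewrite addnAC leq_addl.
have n_gt0 : (0 < n)%N := leq_ltn_trans (leq0n _) lt_n.
have m_gt0 : (0 < m)%N by apply: leq_trans le_tm; apply: leq_trans (leq_tau c n).
have t_gt0 : 0 < (copies c n)%:R :> R by rewrite ltr0n expn_gt0 n_gt0.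
have md_gt0 : 0 < m%:R ^+ d :> R by rewrite exprn_gt0 ?ltr0n.
have nc_gt0 : 0 < n%:R ^+ c :> R by rewrite exprn_gt0 ?ltr0n.
rewrite leNgt; apply/negP => large.
have {}large : (m%:R ^+ d)^-1 < inversion_prob R (amplify F c) q G m.
  apply: le_lt_trans large; rewrite -powR_mulrn // -powRN.
  by apply: ler_powR; [rewrite ler1n | rewrite lerN2 ltW].
(* [beta] is half of the gap that weak one-wayness guarantees, and [delta] is chosen so that
   [t * delta] is half of [m^-d]. *)
pose beta : R := (n%:R ^+ c)^-1 / 2.
pose delta : R := (m%:R ^+ d)^-1 / (2 * (copies c n)%:R).
have beta1 : beta <= 1.
  rewrite /beta -invfM invf_le1 ?mulr_gt0 //.
  by rewrite -natrX -natrM ler1n muln_gt0 expn_gt0 n_gt0.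
have delta0 : 0 <= delta by rewrite divr_ge0 ?invr_ge0 ?mulr_ge0 ?ltW.
have delta1 : delta <= 1.
  rewrite /delta -invfM invf_le1 ?mulr_gt0 //.
  by rewrite -natrX -!natrM ler1n !muln_gt0 !expn_gt0 n_gt0 m_gt0.
have lt_mM : (m <= max_length c n)%N by rewrite /max_length expnS ltnW.
have md_le : m%:R ^+ d <= n.+1%:R ^+ (c.+2 * d) :> R.
  by rewrite exprM -!natrX ler_nat leq_exp2r // ; case: (d).
(* As [t * beta = n / 2], the power is at most [exp (- n / 2)], which is below half of [m^-d]
   because [m] is at most [(n + 1)^(c + 2)]. *)
have small1 : (1 - beta) ^+ copies c n <= (m%:R ^+ d)^-1 / 2.
  apply: le_trans (exprn_le_expR _ beta1) _.
  have -> : (copies c n)%:R * beta = n%:R / 2.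
    by rewrite /copies natrX exprS /beta; field; rewrite expf_neq0 // pnatr_eq0 -lt0n.
  rewrite expRN -invfM lef_pV2 ?posrE ?expR_gt0 ?mulr_gt0 //.
  by apply: le_trans (H1 n le_n1); rewrite mulrC ler_pM2l.
(* The number of rounds times [delta] is [(max_length / m)^d * n], at least [n], and [exp (- n / 2)]
   is at most [n^-c / 2]. *)
have small2 : (1 - delta) ^+ rounds c d n <= beta.
  apply: le_trans (exprn_le_expR _ delta1) _.
  apply: (@le_trans _ _ (expR (- (n%:R / 2)))).
    rewrite ler_expR lerN2.
    have -> : (rounds c d n)%:R * delta = (max_length c n)%:R ^+ d / m%:R ^+ d * n%:R.
      rewrite /rounds /delta; move: (copies c n) (max_length c n) t_gt0 => t M t_gt0.
      rewrite !natrM natrX; field.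
      by rewrite !lt0r_neq0.
    apply: (@le_trans _ _ (1 * n%:R)).
      by rewrite mulrC ler_wpM2r // invf_le1 // ler1n.
    apply: ler_wpM2r => //; rewrite ler_pdivlMr // mul1r -!natrX ler_nat.
    by case: (d) => // ?; rewrite leq_exp2r.
  rewrite expRN /beta -invfM lef_pV2 ?posrE ?expR_gt0 ?mulr_gt0 //.
  apply: le_trans (H2 n le_n2).
  by rewrite mulrC ler_pM2l // lerXn2r ?nnegrE // ler_nat.
have mass : (copies c n)%:R * delta + (1 - beta) ^+ copies c n <
  inversion_prob R (amplify F c) q G m.
  apply: le_lt_trans large.
  have -> : (m%:R ^+ d)^-1 = (copies c n)%:R * delta + (m%:R ^+ d)^-1 / 2 :> R.
    by rewrite /delta; field; rewrite !lt0r_neq0.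
  by rewrite lerD2l.
have delta01 : 0 <= delta <= 1 by rewrite delta0.
have inv := inverter_prob d g_spec erefl delta01 mass.
(* The inverter succeeds with probability above [1 - beta - (1 - delta)^rounds], which is at least
   [1 - 2 * beta = 1 - n^-c]. This contradicts weak one-wayness at [n]. *)
have := lt_le_trans inv (H0 n le_n0); rewrite powRN powR_mulrn //.
have -> : (n%:R ^+ c)^-1 = beta + beta by rewrite /beta; field; rewrite lt0r_neq0.
by lra.
Qed.
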